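(* Suppose that Assumptions 1, 2 and 3 stated in the context hold. Then the sequence of iterates $\{x_k\}_{k\in\mathbb{N}}$ generated by the ASMOP algorithm (described in the context) satisfies $$\liminf_{k\to\infty}\omega(x_k)=0\quad\text{almost surely}.$$ Moreover, if the sequence of iterates is bounded, then almost surely there exists an accumulation point of the sequence $\{x_k\}_{k\in\mathbb{N}}$ which is a Pareto critical point for the problem $\min_{x\in\mathbb{R}^n} f(x)=(f^1(x),\dots,f^q(x))^T$.
   Context: **Problem.** Consider $\min_{x\in\mathbb{R}^n} f(x)=(f^1(x),\dots,f^q(x))^T$ with $f^i(x)=\frac1N\sum_{j\in\mathcal{N}^i}f^i_j(x)$, $i=1,\dots,q$, where each $\mathcal{N}^i$ is an index set with $|\mathcal{N}^i|=N$ (identified with $\{1,\dots,N\}$); the component functions are smooth with Lipschitz-continuous gradients. The marginal function is $\omega(x)=-\min_{\|d\|\le1}\max_{i}\langle\nabla f^i(x),d\rangle$. A point $x$ is Pareto critical if there is no $d\in\mathbb{R}^n$ with $\langle\nabla f^i(x),d\rangle<0$ for all $i$ (equivalently, $\omega(x)=0$). Put $\phi(x)=\max_i f^i(x)$. **Subsampled quantities.** For $\mathcal{N}_k=(\mathcal{N}_k^1,\dots,\mathcal{N}_k^q)$ with $\emptyset\ne\mathcal{N}^i_k\subseteq\mathcal{N}^i$, $N_k^i=|\mathcal{N}_k^i|$, let $f^i_{\mathcal{N}^i_k}=\frac1{N^i_k}\sum_{j\in\mathcal{N}^i_k}f^i_j$, $\phi_{\mathcal{N}_k}(x)=\max_i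 f^i_{\mathcal{N}^i_k}(x)$, $\omega_{\mathcal{N}_k}(x)=-\min_{\|d\|\le1}\max_i\langle\nabla f^i_{\mathcal{N}^i_k}(x),d\rangle$. With Hessian approximations $H^i_k$, the model is $m_{\mathcal{N}_k}(d)=\max_i\{f^i_{\mathcal{N}^i_k}(x_k)+\langle\nabla f^i_{\mathcal{N}^i_k}(x_k),d\rangle+\frac12\langle d,H^i_kd\rangle\}$, and $\beta_k=1+\max_i\|H^i_k\|$. For a sample (with possible repetitions) $\mathcal{D}_k=(\mathcal{D}^1_k,\dots,\mathcal{D}^q_k)$ with $D_k^i=|\mathcal{D}_k^i|$, let $f^i_{\mathcal{D}^i_k}=\frac1{D^i_k}\sum_{j\in\mathcal{D}^i_k}f^i_j$ and $\phi_{\mathcal{D}_k}(x)=\max_i f^i_{\mathcal{D}^i_k}(x)$. Let $h^i_k=(N-N^i_k)/N$ and $M^k_b=\{i: N^i_k<N\}$. **Algorithm ASMOP.** Initialization: $x_0\in\mathbb{R}^n$, $\delta_{max}>0$, $\delta_0\in(0,\delta_{max})$, $\gamma_1\in(0,1)$, $\gamma_2=1/\gamma_1$, $\nu,\varepsilon>0$, $\eta\in(0,\frac34)$, predetermined sequences $t_k>0$, $\overline{t}_k>0$ with $\sum_{k\ge0}t_k\le t<\infty$, $\sum_{k\ge0}\overline{t}_k\le\overline{t}<\infty$, initial samples $\mathcal{N}_0$. At iteration $k=0,1,\dots$: Step 1. Find $d_k$ with $\|d_k\|\le\delta_k$ and $m_{\mathcal{N}_k}(0)-m_{\mathcal{N}_k}(d_k)\ge\frac12\omega_{\mathcal{N}_k}(x_k)\min\{\delta_k,\omega_{\mathcal{N}_k}(x_k)/\beta_k\}$.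 Set $x_t=x_k+d_k$ (the trial point) and $\rho_{\mathcal{N}_k}=\dfrac{\phi_{\mathcal{N}_k}(x_t)-\phi_{\mathcal{N}_k}(x_k)-\delta_kt_k}{m_{\mathcal{N}_k}(d_k)-m_{\mathcal{N}_k}(0)}$. Step 2 (sample update). If $M^k_b=\emptyset$ (FS phase), go to Step 3 (full samples are kept). Otherwise (MB phase), draw $\mathcal{D}_k$, independently of $\mathcal{N}_k$: for $i\in M^k_b$, $\mathcal{D}^i_k$ is drawn uniformly at random with replacement from $\mathcal{N}^i$ with size $D^i_k<N$; for $i\notin M^k_b$, $\mathcal{D}^i_k=\mathcal{N}^i$. Compute $\rho_{\mathcal{D}_k}=\dfrac{\phi_{\mathcal{D}_k}(x_t)-\phi_{\mathcal{D}_k}(x_k)-\delta_k\overline{t}_k}{-\max_i\|\nabla f^i_{\mathcal{D}^i_k}(x_k)\|}$; the condition $\rho_{\mathcal{D}_k}\ge\nu$ is understood as $\phi_{\mathcal{D}_k}(x_t)\le\phi_{\mathcal{D}_k}(x_k)+\delta_k\overline{t}_k-\nu\max_i\|\nabla f^i_{\mathcal{D}^i_k}(x_k)\|$. For each $i\in M^k_b$: if $\omega_{\mathcal{N}_k}(x_k)<\varepsilon h^i_k$ or $\rho_{\mathcal{D}_k}<\nu$, choose $N^i_{k+1}\in(N^i_k,N]$ and choose a new $\mathcal{N}^i_{k+1}$ of that size; otherwise, if $\rho_{\mathcal{N}_k}<\eta$, set $N^i_{k+1}=N^i_k$ and $\mathcal{N}^i_{k+1}=\mathcal{N}^i_k$;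 otherwise set $N^i_{k+1}=N^i_k$ and choose $\mathcal{N}^i_{k+1}$ of that size. For $i\notin M_b^k$ the full sample is kept. Step 3 (iterate update). In the MB phase ($M^k_b\ne\emptyset$): $x_{k+1}=x_t$ if $\rho_{\mathcal{N}_k}\ge\eta$ and $\rho_{\mathcal{D}_k}\ge\nu$, else $x_{k+1}=x_k$. In the FS phase ($M^k_b=\emptyset$): $x_{k+1}=x_t$ if $\rho_{\mathcal{N}_k}\ge\eta$, else $x_{k+1}=x_k$. Step 4 (radius update). $\delta_{k+1}=\min\{\delta_{max},\gamma_2\delta_k\}$ if $\rho_{\mathcal{N}_k}\ge\eta$, else $\delta_{k+1}=\gamma_1\delta_k$. **Scenarios.** For a sample path, $M_b=\{i: N^i_k<N\ \forall k\in\mathbb{N}\}$. MB is the event (set of sample paths) $M_b\ne\emptyset$; FS is the event $M_b=\emptyset$. The set $\mathcal{D}_k^-$ denotes the set of possible outcomes of $\mathcal{D}_k$ for which $\phi_{\mathcal{D}_k}(x_t)>\phi_{\mathcal{D}_k}(x_k)+\delta_k\overline{t}_k-\nu\max_i\|\nabla f^i_{\mathcal{D}^i_k}(x_k)\|$. On MB, $k_0$ denotes a random finite iteration (existing almost surely on MB) such that $\mathcal{D}^-_k=\emptyset$ for all $k\ge k_0$. On FS, $k_1$ denotes a random finite iteration such that $N^i_k=N$ for all $i$ and all $k\ge k_1$. **Assumption 1.** All functions $f^i_j$, $j\in\mathcal{N}^i$, $i=1,\dots,q$, are twice continuously differentiable and bounded from below. **Assumption 2.** There is $c_h>0$ with $\|\nabla^2f^i_j(x)\|\le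 c_h$ for all $x\in\mathbb{R}^n$, $j\in\mathcal{N}^i$, $i=1,\dots,q$, and there is $c_b>0$ with $\beta_k\le c_b$ for all $k\in\mathbb{N}$. **Assumption 3.** There is $C>0$ such that for all $i=1,\dots,q$ and $j\in\mathcal{N}^i$: $\mathbb{E}(|f^i_j(x_{k_0})|\mid MB)\le C$ and $\mathbb{E}(|f^i_j(x_{k_1})|\mid FS)\le C$. (Conditioning on MB or FS is understood when that event has positive probability.) *)

(* Defs.v *)
From mathcomp Require Import all_boot all_order all_algebra.
From mathcomp Require Import all_classical all_reals all_analysis.

Set Implicit Arguments.
Unset Strict Implicit.
Unset Printing Implicit Defensive.

Import Order.TTheory GRing.Theory Num.Theory.
Import numFieldNormedType.Exports.

Local Open Scope classical_set_scope.
Local Open Scope ring_scope.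

(* Points of R^n are row vectors. The library norm on 'rV[R]_n is the sup norm,
   so the Euclidean structure is defined here; the topologies (hence
   differentiability, boundedness and cluster points) are the same. *)

Definition dotv (R : realType) (n : nat) (u v : 'rV[R]_n) : R :=
  (u *m v^T) 0 0.

Definition enorm (R : realType) (n : nat) (u : 'rV[R]_n) : R :=
  Num.sqrt (dotv u u).

(* The spectral norm; A and A^T have the same one, so acting on rows is
   harmless. *)
Definition opnorm (R : realType) (n : nat) (A : 'M[R]_n) : R :=
  sup [set enorm (v *m A) | v in [set v : 'rV[R]_n | enorm v <= 1]].

Definition grad (R : realType) (n : nat) (g : 'rV[R]_n -> R) (x : 'rV[R]_n) :
    'rV[R]_n :=
  \row_j 'D_(delta_mx 0 j) g x.

Definition hessian (R : realType) (n : nat) (g : 'rV[R]_n -> R)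
    (x : 'rV[R]_n) : 'M[R]_n :=
  jacobian (grad g) x.

Definition twice_cont_diff (R : realType) (n : nat) (g : 'rV[R]_n -> R) : Prop :=
  [/\ forall x, differentiable g x,
      forall x, differentiable (grad g) x
    & continuous (hessian g)].

Definition lipschitz_grad (R : realType) (n : nat) (g : 'rV[R]_n -> R) : Prop :=
  exists L : R, forall x y, enorm (grad g x - grad g y) <= L * enorm (x - y).

Definition bounded_below (R : realType) (n : nat) (g : 'rV[R]_n -> R) : Prop :=
  exists m : R, forall x, m <= g x.

(* Everywhere below there are q.+1 objectives, so that maxima over them make
   sense. *)
Definition maxq (R : realType) (q : nat) (a : 'I_q.+1 -> R) : R :=
  \big[Num.max/a ord0]_(i < q.+1) a i.

Section Multiobjective.
Variables (R : realType) (n q : nat).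
Implicit Types (F : 'I_q.+1 -> 'rV[R]_n -> R) (x : 'rV[R]_n).

Definition phi F x : R := maxq (fun i => F i x).

(* The minimum over the unit ball is attained, so it is the infimum. *)
Definition omega F x : R :=
  - inf [set maxq (fun i => dotv (grad (F i) x) v)
        | v in [set v : 'rV[R]_n | enorm v <= 1]].

Definition pareto_critical F x : Prop :=
  ~ exists v : 'rV[R]_n, forall i, dotv (grad (F i) x) v < 0.

Definition model F (H : 'I_q.+1 -> 'M[R]_n) x (v : 'rV[R]_n) : R :=
  maxq (fun i =>
    F i x + dotv (grad (F i) x) v + 2^-1 * dotv (v *m H i) v).

Definition beta (H : 'I_q.+1 -> 'M[R]_n) : R :=
  1 + maxq (fun i => opnorm (H i)).

Variable N : nat.
Variable f : 'I_q.+1 -> 'I_N -> 'rV[R]_n -> R.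

Definition objective (i : 'I_q.+1) x : R :=
  N%:R^-1 * \sum_(j < N) f i j x.

Definition set_objective (S : 'I_q.+1 -> {set 'I_N}) (i : 'I_q.+1) x : R :=
  #|S i|%:R^-1 * \sum_(j in S i) f i j x.

(* Samples drawn with replacement are sequences, repetitions counted. *)
Definition seq_objective (D : 'I_q.+1 -> seq 'I_N) (i : 'I_q.+1) x : R :=
  (size (D i))%:R^-1 * \sum_(j <- D i) f i j x.

End Multiobjective.

Record asmop_params (R : realType) (n : nat) := AsmopParams {
  x_init : 'rV[R]_n;
  delta_init : R;
  delta_max : R;
  gamma1 : R;
  nu : R;
  eps : R;
  eta : R;
  tseq : nat -> R;
  tbarseq : nat -> R }.

Definition valid_params (R : realType) (n : nat) (par : asmop_params R n) : Prop :=
  0 < delta_max par /\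
  0 < delta_init par < delta_max par /\
  0 < gamma1 par < 1 /\
  0 < nu par /\ 0 < eps par /\
  0 < eta par < 3 / 4 /\
  (forall k, 0 < tseq par k) /\ (forall k, 0 < tbarseq par k) /\
  (\sum_(0 <= k <oo) (tseq par k)%:E < +oo)%E /\
  (\sum_(0 <= k <oo) (tbarseq par k)%:E < +oo)%E.

(* The data of one sample path: x_k, delta_k, N_k, H_k, d_k, the sizes D_k^i and
   the samples D_k. The last two are meaningful in the MB phase only. *)
Record sample_path (R : realType) (n q N : nat) := SamplePath {
  iterate : nat -> 'rV[R]_n;
  tr_radius : nat -> R;
  batch : nat -> 'I_q.+1 -> {set 'I_N};
  hess : nat -> 'I_q.+1 -> 'M[R]_n;
  step : nat -> 'rV[R]_n;
  dsize : nat -> 'I_q.+1 -> nat;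
  dsample : nat -> 'I_q.+1 -> seq 'I_N }.

Section Path.
Variables (R : realType) (n q N : nat).
Variable f : 'I_q.+1 -> 'I_N -> 'rV[R]_n -> R.
Variable par : asmop_params R n.
Variable s : sample_path R n q N.
Implicit Types (k : nat) (i : 'I_q.+1).

Definition trial k : 'rV[R]_n := iterate s k + step s k.

Definition fN k : 'I_q.+1 -> 'rV[R]_n -> R := set_objective f (batch s k).

Definition mN k (v : 'rV[R]_n) : R :=
  model (fN k) (hess s k) (iterate s k) v.

Definition omegaN k : R := omega (fN k) (iterate s k).

(* M_b^k; the MB phase is Mb k != set0. *)
Definition Mb k : {set 'I_q.+1} := [set i | (#|batch s k i| < N)%N]%SET.

Definition hfrac k i : R := (N%:R - #|batch s k i|%:R) / N%:R.

(* If the denominator vanishes, division by 0 gives rhoN k = 0, which is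
   below eta. *)
Definition rhoN k : R :=
  (phi (fN k) (trial k) - phi (fN k) (iterate s k) - tr_radius s k * tseq par k)
  / (mN k (step s k) - mN k 0).

(* The division-free meaning of rho_D >= nu for the sample D. *)
Definition rhoD_ge_nu k (D : 'I_q.+1 -> seq 'I_N) : bool :=
  phi (seq_objective f D) (trial k) <=
    phi (seq_objective f D) (iterate s k) + tr_radius s k * tbarseq par k
    - nu par * maxq (fun i => enorm (grad (seq_objective f D i) (iterate s k))).

Definition possible_sample k (D : 'I_q.+1 -> seq 'I_N) : Prop :=
  forall i, if i \in Mb k then size (D i) = dsize s k i else D i = enum 'I_N.

Definition Dminus k : set ('I_q.+1 -> seq 'I_N) :=
  [set D | possible_sample k D /\ ~~ rhoD_ge_nu k D].

Definition initialization : Prop :=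
  [/\ iterate s 0 = x_init par,
      tr_radius s 0 = delta_init par
    & forall i, batch s 0 i != finset.set0].

Definition step1 k : Prop :=
  enorm (step s k) <= tr_radius s k /\
  2^-1 * omegaN k * Num.min (tr_radius s k) (omegaN k / beta (hess s k))
    <= mN k 0 - mN k (step s k).

Definition step2 k : Prop :=
  if Mb k == finset.set0 then forall i, batch s k.+1 i = batch s k i
  else
    [/\ forall i, i \in Mb k -> (0 < dsize s k i < N)%N,
        possible_sample k (dsample s k)
      & forall i,
        if i \notin Mb k then batch s k.+1 i = batch s k i
        else if (omegaN k < eps par * hfrac k i)
                || ~~ rhoD_ge_nu k (dsample s k)
             then (#|batch s k i| < #|batch s k.+1 i|)%N : Prop
        else if rhoN k < eta par then batch s k.+1 i = batch s k i
        else #|batch s k.+1 i| = #|batch s k i|].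

Definition step3 k : Prop :=
  iterate s k.+1 =
    if (eta par <= rhoN k) &&
       ((Mb k == finset.set0) || rhoD_ge_nu k (dsample s k))
    then trial k else iterate s k.

Definition step4 k : Prop :=
  tr_radius s k.+1 =
    if eta par <= rhoN k
    then Num.min (delta_max par) ((gamma1 par)^-1 * tr_radius s k)
    else gamma1 par * tr_radius s k.

Definition asmop_path : Prop :=
  initialization /\ forall k, [/\ step1 k, step2 k, step3 k & step4 k].

Definition Mb_forever : set 'I_q.+1 := [set i | forall k, i \in Mb k].

End Path.

Section Random.
Variables (R : realType) (n q N : nat).
Variable f : 'I_q.+1 -> 'I_N -> 'rV[R]_n -> R.
Variable par : asmop_params R n.
Variables (d : measure_display) (T : measurableType d) (P : probability T R).
Variable run : T -> sample_path R n q N.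

Definition MB : set T := [set w | Mb_forever (run w) !=set0].
Definition FS : set T := [set w | Mb_forever (run w) = set0].

(* G k is the information available when D_k is about to be drawn. Random
   points of R^n are measurable for the Borel sets, which the open sets
   generate. *)
Definition history (G : nat -> set (set T)) : Prop :=
  (forall k, sigma_algebra setT (G k)) /\
  (forall k, G k `<=` measurable) /\
  (forall k, G k `<=` G k.+1) /\
  (forall k (U : set 'rV[R]_n), open U ->
     G k [set w | U (iterate (run w) k)] /\ G k [set w | U (trial (run w) k)]) /\
  (forall k (B : set R), measurable B -> G k [set w | B (tr_radius (run w) k)]) /\
  (forall k i (S : {set 'I_N}), G k [set w | batch (run w) k i = S]) /\
  (forall k i (m : nat), G k [set w | dsize (run w) k i = m]) /\
  (forall k i (D : seq 'I_N), G k.+1 [set w | dsample (run w) k i = D]).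

(* Given the past, on the event that B is the set of subsampled objectives and
   m gives the sizes, the D_k^i, i in B, are independent and uniform on the
   sequences of length m i: each outcome has probability prod_(i in B) N^-(m i). *)
Definition uniform_sampling (G : nat -> set (set T)) : Prop :=
  forall k (B : {set 'I_q.+1}) (m : 'I_q.+1 -> nat) (A : set T),
    G k A ->
    A `<=` [set w | Mb (run w) k = B /\
                    forall i, i \in B -> dsize (run w) k i = m i] ->
    forall D : 'I_q.+1 -> seq 'I_N, (forall i, i \in B -> size (D i) = m i) ->
      P (A `&` [set w | forall i, i \in B -> dsample (run w) k i = D i]) =
      (P A * (\prod_(i in B) N%:R^-1 ^+ m i)%:E)%E.

Definition asmop_process : Prop :=
  (forall w, asmop_path f par (run w)) /\
  exists G, history G /\ uniform_sampling G.

(* On MB, k0 w is an iteration from which on all Dminus are empty, provided such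
   an iteration exists; that it exists almost surely is not assumed. *)
Definition is_k0 (k0 : T -> nat) : Prop :=
  measurable_fun setT k0 /\
  forall w, MB w ->
    (exists K, forall k, (K <= k)%N -> Dminus f par (run w) k = set0) ->
    forall k, (k0 w <= k)%N -> Dminus f par (run w) k = set0.

Definition is_k1 (k1 : T -> nat) : Prop :=
  measurable_fun setT k1 /\
  forall w, FS w -> forall k, (k1 w <= k)%N ->
    forall i, #|batch (run w) k i| = N.

(* E(X | A) for an event A of positive probability. *)
Definition cond_expectation (A : set T) (X : T -> R) : \bar R :=
  (((fine (P A))^-1)%:E * \int[P]_(w in A) (X w)%:E)%E.

Definition assumption1 : Prop :=
  forall i j, twice_cont_diff (f i j) /\ bounded_below (f i j).

Definition assumption2 : Prop :=
  (exists2 ch : R, 0 < ch & forall i j x, opnorm (hessian (f i j) x) <= ch) /\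
  (exists2 cb : R, 0 < cb & forall w k, beta (hess (run w) k) <= cb).

Definition assumption3 (k0 k1 : T -> nat) : Prop :=
  exists2 C : R, 0 < C & forall i j,
    ((0 < P MB)%E ->
      (cond_expectation MB (fun w => `|f i j (iterate (run w) (k0 w))|)%R
        <= C%:E)%E) /\
    ((0 < P FS)%E ->
      (cond_expectation FS (fun w => `|f i j (iterate (run w) (k1 w))|)%R
        <= C%:E)%E).

End Random.

(* Main.v *)
Require Import Defs.
From mathcomp Require Import all_boot all_order all_algebra.
From mathcomp Require Import all_classical all_reals all_analysis measurable_realfun.
From mathcomp Require Import ring lra.

Set Implicit Arguments.
Unset Strict Implicit.
Unset Printing Implicit Defensive.

Import Order.TTheory GRing.Theory Num.Theory.
Import numFieldNormedType.Exports.

Local Open Scope classical_set_scope.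
Local Open Scope ring_scope.

(** The mini-batch scenario has probability zero, and on the full-sampling
    scenario the conclusion holds path by path.

    Full sampling.  From some iteration on, every subsampled quantity is the
    exact one, so ASMOP is a trust-region method for the maximum [phi] of the
    objectives.  If omega stayed above some e > 0, then every step with a small
    enough radius would be successful, because the model is exact up to a
    quadratic term ([small_radius_success]); hence the radius would stay away
    from 0 and successes would recur ([recurrent_successes]).  Each of them
    would decrease [phi] by a fixed amount, up to the summable relaxation
    delta_max * t_k, although [phi] is bounded below ([descent_cvg0],
    [full_sampling_omega]).

    Mini-batch.  The batch sizes are nondecreasing and bounded, hence stationary,
    and from then on the algorithm never asks for a larger batch.  So
    omega_(N_k)(x_k) >= eps / N, and every sample D_k that is drawn passes the
    additional test.  Each possible sample has a conditional probability bounded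
    away from 0; if it failed the test at infinitely many iterations, it would
    almost surely be drawn at infinitely many of them
    ([conditional_borel_cantelli]).  Hence, almost surely, every possible sample
    eventually passes the test.  Apply this to the samples that repeat one index
    j_i for each subsampled objective i: the test says that the maximum of the
    chosen components f^i_(j_i) and of the fully sampled objectives decreases at
    every success by nu times the largest of their gradient norms, up to a
    summable term.  These maxima are bounded below, so all those gradients tend
    to 0 along the successes, and so does omega_(N_k)(x_k), which contradicts
    omega_(N_k)(x_k) >= eps / N
    ([minibatch_contradiction], [minibatch_negligible]).

    Since omega is small along a subsequence and, by continuity of the gradients,
    bounded away from 0 near a point that is not Pareto critical, a cluster point
    of that subsequence is Pareto critical ([bounded_cluster_critical]). *)

(** * Euclidean geometry of row vectors *)

Section Euclidean.
Variables (R : realType) (n : nat).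
Implicit Types (u v w : 'rV[R]_n) (a : R).

Lemma dotvE u v : dotv u v = \sum_j u 0 j * v 0 j.
Proof. by rewrite /dotv !mxE; apply: eq_bigr => j _; rewrite mxE. Qed.

Lemma dotvC u v : dotv u v = dotv v u.
Proof. by rewrite !dotvE; apply: eq_bigr => j _; rewrite mulrC. Qed.

Lemma dotvDl u v w : dotv (u + v) w = dotv u w + dotv v w.
Proof. by rewrite /dotv mulmxDl mxE. Qed.

Lemma dotvZl a u v : dotv (a *: u) v = a * dotv u v.
Proof. by rewrite /dotv -scalemxAl mxE. Qed.

Lemma dotvDr u v w : dotv u (v + w) = dotv u v + dotv u w.
Proof. by rewrite dotvC dotvDl !(dotvC u). Qed.

Lemma dotvZr a u v : dotv u (a *: v) = a * dotv u v.
Proof. by rewrite dotvC dotvZl dotvC. Qed.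

Lemma dotv0l v : dotv 0 v = 0.
Proof. by rewrite /dotv mul0mx mxE. Qed.

Lemma dotv0r v : dotv v 0 = 0.
Proof. by rewrite dotvC dotv0l. Qed.

Lemma dotvBl u v w : dotv (u - v) w = dotv u w - dotv v w.
Proof. by rewrite dotvDl -scaleN1r dotvZl mulN1r. Qed.

Lemma dotvBr u v w : dotv u (v - w) = dotv u v - dotv u w.
Proof. by rewrite dotvC dotvBl !(dotvC u). Qed.

Lemma dotvv_ge0 v : 0 <= dotv v v.
Proof. by rewrite dotvE sumr_ge0 // => j _; rewrite -expr2 sqr_ge0. Qed.

Lemma dotvv_eq0 v : dotv v v = 0 -> v = 0.
Proof.
rewrite dotvE => /eqP; rewrite psumr_eq0; last by move=> j _; rewrite -expr2 sqr_ge0.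
move=> /allP h; apply/rowP => j; rewrite mxE.
by have := h j (mem_index_enum j); rewrite /= mulf_eq0 orbb => /eqP.
Qed.

Lemma enorm_ge0 v : 0 <= enorm v.
Proof. exact: sqrtr_ge0. Qed.

Lemma enorm_sqr v : enorm v ^+ 2 = dotv v v.
Proof. by rewrite sqr_sqrtr ?dotvv_ge0. Qed.

Lemma enorm0 : enorm (0 : 'rV[R]_n) = 0.
Proof. by rewrite /enorm dotv0l sqrtr0. Qed.

Lemma enormZ a v : enorm (a *: v) = `|a| * enorm v.
Proof.
by rewrite /enorm dotvZl dotvZr mulrA -expr2 sqrtrM ?sqr_ge0 // sqrtr_sqr.
Qed.

(** Expand 0 <= |c u - b v|^2 with b = <u, v> and c = <v, v>, and cancel c. *)
Lemma cauchy_schwarz u v : `|dotv u v| <= enorm u * enorm v.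
Proof.
rewrite -ler_sqr ?nnegrE ?mulr_ge0 ?enorm_ge0 //.
rewrite real_normK ?num_real // exprMn !enorm_sqr.
have [/dotvv_eq0 ->|c0] := eqVneq (dotv v v) 0; first by rewrite !dotv0r expr2 !mulr0.
have c_gt0 : 0 < dotv v v by rewrite lt_neqAle eq_sym c0 dotvv_ge0.
have := dotvv_ge0 (dotv v v *: u - dotv u v *: v).
rewrite !(dotvBl, dotvBr, dotvZl, dotvZr) (dotvC v u) => h.
rewrite -(ler_pM2l c_gt0) -subr_ge0; apply: le_trans h _.
by rewrite le_eqVlt; apply/orP; left; apply/eqP; ring.
Qed.

Lemma dotv_le u v : dotv u v <= enorm u * enorm v.
Proof. exact: le_trans (ler_norm _) (cauchy_schwarz u v). Qed.

Lemma enormD u v : enorm (u + v) <= enorm u + enorm v.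
Proof.
rewrite -ler_sqr ?nnegrE ?addr_ge0 ?enorm_ge0 //.
rewrite sqrrD !enorm_sqr dotvDl !dotvDr (dotvC v u).
have := dotv_le u v; lra.
Qed.

Lemma enorm_sum (I : Type) (r : seq I) (P : pred I) (F : I -> 'rV[R]_n) :
  enorm (\sum_(i <- r | P i) F i) <= \sum_(i <- r | P i) enorm (F i).
Proof.
elim/big_ind2: _ => [|x1 x2 y1 y2 h1 h2|//]; first by rewrite enorm0.
exact: le_trans (enormD _ _) (lerD h1 h2).
Qed.

(** A crude bound: only its existence matters, since it makes the supremum that
    defines the operator norm an actual upper bound. *)
Lemma enorm_mx_bounded (A : 'M[R]_n) v :
  enorm v <= 1 -> enorm (v *m A) <= \sum_j enorm (row j A).
Proof.
move=> v1; rewrite mulmx_sum_row; apply: le_trans (enorm_sum _ _ _) _.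
apply: ler_sum => j _; rewrite enormZ ler_piMl ?enorm_ge0 //.
apply: le_trans v1; rewrite -ler_sqr ?nnegrE ?enorm_ge0 //.
rewrite enorm_sqr real_normK ?num_real // dotvE (bigD1 j) //= -expr2.
by rewrite lerDl sumr_ge0 // => i _; rewrite -expr2 sqr_ge0.
Qed.

Lemma opnorm_ub (A : 'M[R]_n) v : enorm v <= 1 -> enorm (v *m A) <= opnorm A.
Proof.
move=> v1; apply: ub_le_sup; last by exists v.
by exists (\sum_j enorm (row j A)) => _ [w w1 <-]; exact: enorm_mx_bounded.
Qed.

Lemma opnorm_ge0 (A : 'M[R]_n) : 0 <= opnorm A.
Proof.
by have := @opnorm_ub A 0; rewrite mul0mx enorm0 => -> //; rewrite ler01.
Qed.

Lemma enorm_mulmx (A : 'M[R]_n) v : enorm (v *m A) <= opnorm A * enorm v.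
Proof.
have [v0|v0] := eqVneq (enorm v) 0.
  have -> : v = 0 by apply: dotvv_eq0; rewrite -enorm_sqr v0 expr0n.
  by rewrite mul0mx enorm0 mulr0.
have vp : 0 < enorm v by rewrite lt_neqAle eq_sym v0 enorm_ge0.
have := @opnorm_ub A ((enorm v)^-1 *: v).
rewrite -scalemxAl !enormZ ger0_norm ?invr_ge0 ?enorm_ge0 // mulVf //.
by move=> /(_ (lexx _)); rewrite mulrC ler_pdivrMr.
Qed.

Lemma quad_form_ge (A : 'M[R]_n) v :
  - (opnorm A * enorm v ^+ 2) <= dotv (v *m A) v.
Proof.
rewrite lerNl; apply: le_trans (ler_norm _) _; rewrite normrN.
apply: le_trans (cauchy_schwarz _ _) _; rewrite expr2 mulrA.
by rewrite ler_wpM2r ?enorm_ge0 ?enorm_mulmx.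
Qed.

Lemma coordv_continuous j : continuous (fun u : 'rV[R]_n => u 0 j).
Proof. by move=> u; exact: coord_continuous. Qed.

Lemma continuous_dotvl v : continuous (fun u => dotv u v).
Proof.
have -> : (fun u => dotv u v) = (fun u => \sum_j u 0 j * v 0 j).
  by apply/funext => u; rewrite dotvE.
apply: continuous_big => [|j _ u]; first exact: add_continuous.
exact: (continuousM (@coordv_continuous j u) (@cst_continuous _ _ (v 0 j) u)).
Qed.

Lemma continuous_enorm : continuous (@enorm R n).
Proof.
move=> u; rewrite /enorm.
apply: (@continuous_comp _ _ _ (fun u => dotv u u) Num.sqrt); last first.
  exact: sqrt_continuous.
have -> : (fun u : 'rV[R]_n => dotv u u) = (fun u => \sum_j u 0 j * u 0 j).
  by apply/funext => w; rewrite dotvE.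
move: u.
apply: continuous_big => [|j _ u]; first exact: add_continuous.
exact: continuousM (@coordv_continuous j u) (@coordv_continuous j u).
Qed.

End Euclidean.

(** * Maxima over the objectives and the marginal function *)

Section Maxq.
Variables (R : realType) (q : nat).
Implicit Types (a b : 'I_q.+1 -> R) (c : R).

Lemma maxq_ge a i : a i <= maxq a.
Proof. exact: le_bigmax. Qed.

Lemma maxq_attained a : exists i, maxq a = a i.
Proof.
rewrite /maxq; elim/big_ind: _ => [|x y [i ->] [j ->]|i _]; first by exists ord0.
  by rewrite /Order.max; case: ifP => _; [exists j|exists i].
by exists i.
Qed.

Lemma maxq_le a c : (forall i, a i <= c) -> maxq a <= c.
Proof. by move=> h; have [i ->] := maxq_attained a. Qed.

Lemma maxq_lt a c : (forall i, a i < c) -> maxq a < c.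
Proof. by move=> h; have [i ->] := maxq_attained a. Qed.

Lemma le_maxqD a b c : (forall i, a i <= b i + c) -> maxq a <= maxq b + c.
Proof.
by move=> h; apply: maxq_le => i; apply: le_trans (h i) _; rewrite lerD2r maxq_ge.
Qed.

Lemma eq_maxq a b : a =1 b -> maxq a = maxq b.
Proof. by move=> /funext ->. Qed.

End Maxq.

Section Omega.
Variables (R : realType) (n q : nat).
Implicit Types (F : 'I_q.+1 -> 'rV[R]_n -> R) (x v : 'rV[R]_n).

Let dir_max F x v := maxq (fun i => dotv (grad (F i) x) v).

Let dir_max_ge F x v : enorm v <= 1 ->
  - maxq (fun i => enorm (grad (F i) x)) <= dir_max F x v.
Proof.
move=> v1; apply: le_trans (maxq_ge _ ord0).
apply: (@le_trans _ _ (- enorm (grad (F ord0) x))).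
  by rewrite lerN2 (maxq_ge (fun i => enorm (grad (F i) x))).
rewrite lerNl; apply: le_trans (ler_norm _) _; rewrite normrN.
by apply: le_trans (cauchy_schwarz _ _) _; rewrite ler_piMr ?enorm_ge0.
Qed.

Lemma omega_le F x : omega F x <= maxq (fun i => enorm (grad (F i) x)).
Proof.
rewrite /omega lerNl; apply: lb_le_inf.
  by exists (dir_max F x 0), 0 => //=; rewrite enorm0 ler01.
by move=> _ [v /= v1 <-]; exact: dir_max_ge.
Qed.

Lemma omega_ge F x v : enorm v <= 1 ->
  - maxq (fun i => dotv (grad (F i) x) v) <= omega F x.
Proof.
move=> v1; rewrite /omega lerN2; apply: ge_inf; last by exists v.
exists (- maxq (fun i => enorm (grad (F i) x))) => _ [w /= w1 <-].
exact: dir_max_ge.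
Qed.

Lemma omega_ge0 F x : 0 <= omega F x.
Proof.
apply: le_trans (omega_ge F x (v := 0) _); last by rewrite enorm0 ler01.
by rewrite oppr_ge0; apply: maxq_le => i; rewrite dotv0r.
Qed.

End Omega.

(** * Gradients and quadratic remainders *)

Section Gradient.
Variables (R : realType) (n : nat).
Implicit Types (g : 'rV[R]_n -> R) (x v : 'rV[R]_n).

Lemma derive_grad g x v : differentiable g x -> 'D_v g x = dotv (grad g x) v.
Proof.
move=> dg; rewrite deriveE // {1}(row_sum_delta v) linear_sum dotvE.
by apply: eq_bigr => j _; rewrite linearZ /= mxE deriveE // mulrC.
Qed.

Lemma is_derive_line g x v (s : R) : (forall y, differentiable g y) ->
  is_derive s 1 (fun t : R => g (x + t *: v)) (dotv (grad g (x + s *: v)) v).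
Proof.
move=> dg; rewrite -derive_grad //.
have E : (fun h : R => h^-1 *: (((fun t : R => g (x + t *: v)) \o shift s) (h *: 1)
            - g (x + s *: v))) =
         (fun h : R => h^-1 *: ((g \o shift (x + s *: v)) (h *: v)
            - g (x + s *: v))).
  apply/funext => h /=; congr (_ *: (g _ - _)).
  by rewrite [h *: 1]mulr1 scalerDl addrCA addrA.
apply: DeriveDef; first by rewrite /derivable E; exact: diff_derivable.
by rewrite /derive E.
Qed.

Lemma mean_value_line g x v : (forall y, differentiable g y) ->
  exists2 s : R, s \in `[0, 1] & g (x + v) - g x = dotv (grad g (x + s *: v)) v.
Proof.
move=> dg.
have [||s s01] := @MVT_segment R (fun t => g (x + t *: v))
    (fun s => dotv (grad g (x + s *: v)) v) 0 1 ler01.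
- by move=> s _; exact: is_derive_line.
- apply: continuous_subspaceT => s; apply: differentiable_continuous.
  by apply/derivable1_diffP; case: (is_derive_line x v s dg).
by rewrite scale1r scale0r addr0 subr0 mulr1 => E; exists s.
Qed.

(** First-order Taylor expansion with a quadratic remainder.  It passes
    to averages term by term, and is exactly the error of the linear model. *)
Definition quad_approx (L : R) g :=
  forall x v, `|g (x + v) - g x - dotv (grad g x) v| <= L * enorm v ^+ 2.

(** By the mean value theorem the remainder is <grad g (x + s v) - grad g x, v>
    for some s in [0, 1], which the Lipschitz condition bounds by L |v|^2. *)
Lemma lipschitz_quad_approx g : (forall y, differentiable g y) ->
  lipschitz_grad g -> exists2 L, 0 <= L & quad_approx L g.
Proof.
(* Nothing in the Lipschitz condition forces its constant to be nonnegative. *)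
move=> dg [L hL]; exists `|L|; first exact: normr_ge0.
move=> x v; have [s /itvP s01 ->] := mean_value_line x v dg.
rewrite -dotvBl; apply: le_trans (cauchy_schwarz _ _) _.
rewrite expr2 mulrA ler_wpM2r ?enorm_ge0 //.
apply: le_trans (hL _ _) _; rewrite addrC addKr enormZ ger0_norm ?s01 //.
apply: le_trans (ler_wpM2r _ (ler_norm L)) _; first by rewrite mulr_ge0 ?enorm_ge0 ?s01.
by rewrite ler_wpM2l // ler_piMl ?enorm_ge0 ?s01.
Qed.

End Gradient.

(** The hypothesis 0 <= c covers the empty sequence, whose mean is 0. *)
Lemma mean_le (R : realFieldType) (X : Type) (r : seq X) (a : X -> R) (c : R) :
  0 <= c -> (forall j, a j <= c) -> (size r)%:R^-1 * \sum_(j <- r) a j <= c.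
Proof.
move=> c0 ac; have [r0|r0] := posnP (size r); first by rewrite r0 invr0 mul0r.
rewrite ler_pdivrMl ?ltr0n //.
elim: r {r0} => [|j r IH]; first by rewrite big_nil mul0r.
by rewrite big_cons /= -natr1 mulrDl mul1r addrC lerD.
Qed.

Section Average.
Variables (R : realType) (n : nat) (J : eqType) (h : J -> 'rV[R]_n -> R).
Implicit Types (r : seq J) (x v : 'rV[R]_n).

(** The common form of the exact, the batch and the sampled objectives. *)
Definition avg r x : R := (size r)%:R^-1 * \sum_(j <- r) h j x.

Lemma avg_ge (lo : R) r x : lo <= 0 -> (forall j, lo <= h j x) -> lo <= avg r x.
Proof.
move=> lo0 hlo; rewrite -lerN2 /avg -mulrN -sumrN.
by apply: mean_le => [|j]; rewrite ?oppr_ge0 ?lerN2.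
Qed.

Lemma avg_nseq m j x : (0 < m)%N -> avg (nseq m j) x = h j x.
Proof.
move=> m0; rewrite /avg size_nseq big_nseq iter_addr addr0.
by rewrite -[h j x *+ m]mulr_natl mulKf // pnatr_eq0 -lt0n.
Qed.

Hypothesis dh : forall j x, differentiable (h j) x.

Lemma differentiable_avg r x : differentiable (avg r) x.
Proof.
rewrite (_ : avg r = (size r)%:R^-1 \*: (fun y => \sum_(j <- r) h j y)) //.
apply: differentiableZ; elim: r => [|j r IH].
  rewrite (_ : (fun _ => _) = cst 0); first exact: differentiable_cst.
  by apply/funext => y; rewrite big_nil.
rewrite (_ : (fun _ => _) = h j + (fun y => \sum_(j <- r) h j y)).
  exact: differentiableD.
by apply/funext => y; rewrite big_cons.
Qed.

Lemma dotv_sum r x v : dotv (\sum_(j <- r) grad (h j) x) v =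
  \sum_(j <- r) dotv (grad (h j) x) v.
Proof.
by elim: r => [|j r IH]; rewrite ?big_nil ?dotv0l // !big_cons dotvDl IH.
Qed.

Lemma is_derive_avg r x v : is_derive x v (avg r)
  ((size r)%:R^-1 * \sum_(j <- r) dotv (grad (h j) x) v).
Proof.
apply: (@is_deriveZ _ _ _ (fun y => \sum_(j <- r) h j y)); elim: r => [|j r IH].
  rewrite big_nil (_ : (fun _ => _) = cst 0); first exact: is_derive_cst.
  by apply/funext => y; rewrite big_nil.
rewrite big_cons (_ : (fun _ => _) = h j + (fun y => \sum_(j <- r) h j y)).
  apply: is_deriveD => //; rewrite -derive_grad //.
  by apply: DeriveDef => //; exact: diff_derivable.
by apply/funext => y; rewrite big_cons.
Qed.

Lemma grad_avg r x :
  grad (avg r) x = (size r)%:R^-1 *: \sum_(j <- r) grad (h j) x.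
Proof.
apply/rowP => i; rewrite mxE (@derive_val _ _ _ _ _ _ _ (is_derive_avg r x _)) mxE.
rewrite summxE; congr (_ * _); apply: eq_bigr => j _.
by rewrite -derive_grad // mxE.
Qed.

Lemma enorm_avg_le (X : Type) (r : seq X) (F : X -> 'rV[R]_n) (c : R) :
  0 <= c -> (forall j, enorm (F j) <= c) ->
  enorm ((size r)%:R^-1 *: \sum_(j <- r) F j) <= c.
Proof.
move=> c0 hF; rewrite enormZ ger0_norm ?invr_ge0 ?ler0n //.
apply: le_trans (mean_le r c0 hF).
by rewrite ler_wpM2l ?invr_ge0 ?ler0n ?enorm_sum.
Qed.

Lemma enorm_grad_avg r x (c : R) : 0 <= c ->
  (forall j, enorm (grad (h j) x) <= c) -> enorm (grad (avg r) x) <= c.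
Proof. by move=> c0 hc; rewrite grad_avg; exact: enorm_avg_le. Qed.

Lemma quad_approx_avg (L : R) r : 0 <= L ->
  (forall j, quad_approx L (h j)) -> quad_approx L (avg r).
Proof.
move=> L0 hL x v; rewrite grad_avg dotvZl dotv_sum /avg -!mulrBr -!sumrB.
rewrite normrM ger0_norm ?invr_ge0 ?ler0n //.
apply: le_trans (mean_le r _ (fun j => hL j x v)); last first.
  by rewrite mulr_ge0 ?exprn_ge0 ?enorm_ge0.
by rewrite ler_wpM2l ?invr_ge0 ?ler0n ?ler_norm_sum.
Qed.

Lemma continuous_grad_avg r : (forall j, continuous (grad (h j))) ->
  continuous (grad (avg r)).
Proof.
move=> hc; rewrite (_ : grad (avg r) =
  fun x => (size r)%:R^-1 *: \sum_(j <- r) grad (h j) x); last first.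
  by apply/funext => x; rewrite grad_avg.
move=> x.
apply: (@continuous_comp _ _ _ (fun y => \sum_(j <- r) grad (h j) y)); last first.
  exact: scaler_continuous.
by move: x; apply: continuous_big => [|j _]; [exact: add_continuous|exact: hc].
Qed.

End Average.
(** * Descent sequences and the radius update *)

Section Sequences.
Variable R : realType.

Lemma nondecreasing_bounded_stationary (s : nat -> nat) (M : nat) :
  (forall k, (s k <= s k.+1)%N) -> (forall k, (s k <= M)%N) ->
  exists K, forall k, (K <= k)%N -> s k = s K.
Proof.
move=> smono sM.
pose P m := `[< exists k, s k = m >].
have exP : exists m, P m by exists (s 0); apply/asboolP; exists 0.
have boundP m : P m -> (m <= M)%N by move=> /asboolP[k <-].
case: (ex_maxnP exP boundP) => _ /asboolP[K <-] Kmax; exists K => k Kk.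
apply/eqP; rewrite eqn_leq Kmax /=; last by apply/asboolP; exists k.
by rewrite -(subnK Kk); elim: (k - K)%N => // n IH; exact: leq_trans IH (smono _).
Qed.

(** The sequence a_k - (b_0 + ... + b_(k-1)) is still bounded below and decreases
    by at least u_k at each late step, so the series of the u_k converges. *)
Lemma descent_cvg0 (a b u : nat -> R) (lo M : R) :
  (forall k, lo <= a k) -> (forall n, \sum_(0 <= k < n) b k <= M) ->
  (forall k, 0 <= u k) -> (\forall k \near \oo, a k.+1 <= a k + b k - u k) ->
  u @ \oo --> (0 : R).
Proof.
move=> a_lo bM u0 [K _ hK].
rewrite -(cvg_shiftn K); apply: cvg_series_cvg_0.
pose a' k := a k - \sum_(0 <= j < k) b j.
have tele n : series (fun k => u (k + K)%N) n <= a' K - a' (n + K)%N.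
  rewrite /series /=; elim: n => [|n IH]; first by rewrite big_geq // add0n subrr.
  rewrite big_nat_recr //=; have := hK (n + K)%N (leq_addl _ _).
  rewrite addSn {2}/a' (@big_nat_recr _ _ _ (n + K)) //= => h.
  by move: IH; rewrite {2}/a'; lra.
apply: nondecreasing_is_cvgn.
  by move=> i j ij; apply: nondecreasing_series => // k _ _; exact: u0.
exists (a' K - lo + M) => _ [n _ <-]; apply: le_trans (tele n) _.
by have := a_lo (n + K)%N; have := bM (n + K)%N; rewrite /a'; lra.
Qed.

(** The radius update of ASMOP, for an arbitrary success predicate. *)
Section Radius.
Variables (delta : nat -> R) (succ : pred nat) (dmax g1 : R).
Hypotheses (g1_01 : 0 < g1 < 1) (delta0 : 0 < delta 0 <= dmax).
Hypothesis deltaS : forall k, delta k.+1 =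
  if succ k then Num.min dmax (g1^-1 * delta k) else g1 * delta k.

Lemma radius_bounds k : 0 < delta k <= dmax.
Proof.
case/andP: g1_01 => g1_gt0 g1_lt1.
elim: k => [//|k /andP[dk_gt0 dk_le]]; rewrite deltaS; case: (succ k).
  by rewrite lt_min ge_min lexx mulr_gt0 ?invr_gt0 // (lt_le_trans dk_gt0).
by rewrite mulr_gt0 //= (le_trans _ dk_le) // ler_piMl ?ltW.
Qed.

(** The radius eventually shrinks only when it exceeds d0, so it cannot fall
    below g1 * d0 from above. *)
Lemma radius_nonvanishing (d0 : R) : 0 < d0 ->
  (\forall k \near \oo, delta k <= d0 -> succ k) ->
  exists2 ds, 0 < ds & \forall k \near \oo, ds <= delta k.
Proof.
move=> d0_gt0 [K _ hK]; case/andP: g1_01 => g1_gt0 g1_lt1.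
exists (Num.min (delta K) (g1 * d0)).
  by rewrite lt_min mulr_gt0 // andbT; case/andP: (radius_bounds K).
exists K => // k /= Kk; rewrite -(subnK Kk); elim: (k - K)%N => [|n IH].
  by rewrite ge_min add0n lexx.
have /andP[dk_gt0 dk_le] := radius_bounds (n + K).
rewrite addSn deltaS; case: ifPn => hs.
  apply: le_trans IH _; rewrite le_min dk_le /= ler_peMl ?ltW //.
  by rewrite invf_gt1.
rewrite ge_min; apply/orP; right; rewrite ler_pM2l //.
rewrite leNgt; apply/negP => lt_d0; case/negP: hs.
by apply: hK; rewrite /= ?leq_addl // ltW.
Qed.

(** Without successes the radius would decay geometrically. *)
Lemma infinitely_many_successes (ds : R) : 0 < ds ->
  (\forall k \near \oo, ds <= delta k) -> forall K, exists2 k, (K <= k)%N & succ k.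
Proof.
move=> ds_gt0 [K1 _ hK1] K; case/andP: g1_01 => g1_gt0 g1_lt1.
apply: contrapT => nex.
have nsucc k : (K <= k)%N -> ~~ succ k.
  by move=> Kk; apply/negP => sk; apply: nex; exists k.
pose K2 := maxn K K1.
have geo n : delta (K2 + n)%N = delta K2 * g1 ^+ n.
  elim: n => [|n IH]; first by rewrite addn0 expr0 mulr1.
  rewrite addnS deltaS ifN; last first.
    by rewrite nsucc // (leq_trans (leq_maxl K K1)) // leq_addr.
  by rewrite IH exprS mulrCA.
have : geometric (delta K2) g1 @ \oo --> (0 : R).
  by apply: cvg_geometric; rewrite ger0_norm ?ltW.
move=> /cvgrPdist_lt /(_ _ ds_gt0)[m _ /(_ m (leqnn m))] /=.
rewrite sub0r normrN; apply/negP; rewrite -leNgt -geo.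
apply: le_trans (ler_norm _); apply: hK1 => /=.
by rewrite (leq_trans (leq_maxr K K1)) // leq_addr.
Qed.

End Radius.
End Sequences.
(** * The trust-region argument *)

Section ModelDecrease.
Variables (R : realType) (n q : nat) (F : 'I_q.+1 -> 'rV[R]_n -> R).
Variables (H : 'I_q.+1 -> 'M[R]_n) (L cb : R).
Hypotheses (F_quad : forall i, quad_approx L (F i)) (H_cb : beta H <= cb).

Lemma model0 x : model F H x 0 = phi F x.
Proof.
by apply: eq_maxq => i; rewrite dotv0r mul0mx dotv0l mulr0 !addr0.
Qed.

Lemma opnorm_le_beta i : opnorm (H i) <= cb.
Proof.
apply: le_trans H_cb; rewrite /beta; have := maxq_ge (fun i => opnorm (H i)) i.
by move=> h; apply: le_trans h _; rewrite lerDr ler01.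
Qed.

Lemma beta_ge1 : 1 <= beta H.
Proof.
rewrite /beta lerDl; apply: le_trans (maxq_ge (fun i => opnorm (H i)) ord0).
exact: opnorm_ge0.
Qed.

Lemma phi_le_model x v :
  phi F (x + v) <= model F H x v + (L + cb / 2) * enorm v ^+ 2.
Proof.
apply: le_maxqD => i.
have /ler_normlP[_ h1] := F_quad i x v.
have h2 := quad_form_ge (H i) v.
have h3 : opnorm (H i) * enorm v ^+ 2 <= cb * enorm v ^+ 2.
  by rewrite ler_wpM2r ?exprn_ge0 ?enorm_ge0 ?opnorm_le_beta.
lra.
Qed.

End ModelDecrease.

Section PathBasics.
Variables (R : realType) (n q N : nat).
Variable f : 'I_q.+1 -> 'I_N -> 'rV[R]_n -> R.

Lemma objective_avg i : objective f i = avg (f i) (enum 'I_N).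
Proof. by apply/funext => x; rewrite /objective /avg size_enum_ord big_enum. Qed.

Lemma set_objective_avg S i : set_objective f S i = avg (f i) (enum (S i)).
Proof. by apply/funext => x; rewrite /set_objective /avg -cardE big_enum. Qed.

Lemma seq_objective_avg D i : seq_objective f D i = avg (f i) (D i).
Proof. by []. Qed.

Lemma full_set_objective (S : 'I_q.+1 -> {set 'I_N}) i :
  #|S i| = N -> set_objective f S i = objective f i.
Proof.
move=> SN; have ST : S i = [set: 'I_N]%SET.
  by apply/eqP; rewrite eqEcard finset.subsetT cardsT card_ord SN leqnn.
by rewrite set_objective_avg objective_avg ST; congr avg; apply: eq_enum => j; rewrite !inE.
Qed.

End PathBasics.

Section TrustRegion.
Variables (R : realType) (n q N : nat).
Variable f : 'I_q.+1 -> 'I_N -> 'rV[R]_n -> R.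
Variables (par : asmop_params R n) (s : sample_path R n q N) (L cb : R).
Hypotheses (par_valid : valid_params par) (path_s : asmop_path f par s).
Hypotheses (df : forall i j x, differentiable (f i j) x).
Hypotheses (L_ge0 : 0 <= L) (f_quad : forall i j, quad_approx L (f i j)).
Hypothesis beta_cb : forall k, beta (hess s k) <= cb.

Let fN_quad k i : quad_approx L (fN f s k i).
Proof. by rewrite /fN set_objective_avg; exact: quad_approx_avg. Qed.

Lemma mN0 k : mN f s k 0 = phi (fN f s k) (iterate s k).
Proof. exact: model0. Qed.

Lemma tr_radius_bounds k : 0 < tr_radius s k <= delta_max par.
Proof.
have [_ [/andP[h1 h2] [g1 _]]] := par_valid.
have [[_ s0 _] hk] := path_s.
apply: (@radius_bounds _ (tr_radius s) (fun k => eta par <= rhoN f par s k)) => //.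
- exact: g1.
- by rewrite s0 h1 ltW.
- by move=> j; have [_ _ _ ->] := hk j.
Qed.

Lemma cb_gt0 : 0 < cb.
Proof. by apply: lt_le_trans (beta_cb 0); apply: lt_le_trans ltr01 (beta_ge1 _). Qed.

(** The decrease that is guaranteed for the model, with the uniform bound cb in
    place of the iteration-dependent beta_k. *)
Definition model_gain k :=
  2^-1 * omegaN f s k * Num.min (tr_radius s k) (omegaN f s k / cb).

Lemma omegaN_ge0 k : 0 <= omegaN f s k.
Proof. exact: omega_ge0. Qed.

Lemma model_gain_ge0 k : 0 <= model_gain k.
Proof.
have /andP[/ltW d0 _] := tr_radius_bounds k.
rewrite mulr_ge0 ?mulr_ge0 ?omegaN_ge0 ?invr_ge0 //.
by rewrite le_min d0 divr_ge0 ?omegaN_ge0 // ltW ?cb_gt0.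
Qed.

Lemma model_gain_le k : model_gain k <= mN f s k 0 - mN f s k (step s k).
Proof.
have [_ /(_ k)[[_ h] _ _ _]] := path_s; apply: le_trans h.
rewrite ler_wpM2l ?mulr_ge0 ?omegaN_ge0 ?invr_ge0 //.
rewrite le_min !ge_min lexx /=; apply/orP; right.
rewrite ler_wpM2l ?omegaN_ge0 // lef_pV2 ?posrE ?cb_gt0 //.
exact: lt_le_trans ltr01 (beta_ge1 _).
Qed.

(** A success makes the ratio rho positive, so its denominator cannot be 0 and is
    thus negative: the ratio test becomes a genuine decrease. *)
Lemma success_decrease k : eta par <= rhoN f par s k ->
  phi (fN f s k) (trial s k) <= phi (fN f s k) (iterate s k)
    + tr_radius s k * tseq par k - eta par * model_gain k.
Proof.
have [_ [_ [_ [_ [_ [/andP[eta0 _] _]]]]]] := par_valid.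
rewrite /rhoN; set A := _ - _ - _; set Q := mN _ _ _ _ - _ => hrho.
have gain := model_gain_le k; have gain0 := model_gain_ge0 k.
have Q0 : Q < 0.
  rewrite lt_neqAle (le_trans _ (_ : - model_gain k <= 0)) ?oppr_le0 //; last first.
    by rewrite lerNr opprB.
  rewrite andbT; apply/eqP => Q0; move: hrho; rewrite Q0 invr0 mulr0.
  by rewrite leNgt eta0.
have : A <= eta par * Q by rewrite -ler_ndivlMr.
have : eta par * Q <= - (eta par * model_gain k).
  by rewrite -mulrN ler_pM2l // lerNr opprB.
by rewrite /A; lra.
Qed.

(** The model overestimates the decrease of [phi] by at most c * delta^2, whereas
    its own decrease is at least e * delta / 2 as soon as delta <= e / cb.  The
    ratio test tolerates the error c * delta^2 up to the fraction 1 - eta of that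
    decrease, which gives the second bound on delta. *)
Lemma small_radius_success (e : R) : 0 < e ->
  exists2 d0, 0 < d0 & forall k, e <= omegaN f s k -> tr_radius s k <= d0 ->
    eta par <= rhoN f par s k.
Proof.
have [_ [_ [_ [_ [_ [/andP[eta0 eta1] [t0 _]]]]]]] := par_valid.
move=> e0; have cb0 := cb_gt0; pose c := L + cb / 2.
have c0 : 0 < c by rewrite ltr_wpDl // divr_gt0.
exists (Num.min (e / cb) ((1 - eta par) * (2^-1 * e) / c)).
  by rewrite lt_min !divr_gt0 // mulr_gt0 ?mulr_gt0 ?invr_gt0 // subr_gt0; lra.
move=> k ek; rewrite le_min => /andP[d1 d2].
have /andP[dpos _] := tr_radius_bounds k.
have [_ /(_ k)[[hd _] _ _ _]] := path_s.
set dk := tr_radius s k in d1 d2 dpos hd.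
have gain : 2^-1 * e * dk <= mN f s k 0 - mN f s k (step s k).
  apply: le_trans (model_gain_le k); rewrite /model_gain -/dk.
  apply: ler_pM => //; [by rewrite mulr_ge0 ?invr_ge0 // ltW|exact: ltW| |].
    by rewrite ler_pM2l ?invr_gt0.
  by rewrite le_min lexx /= (le_trans d1) // ler_pM2r ?invr_gt0.
have upper := phi_le_model (fN_quad k) (beta_cb k) (iterate s k) (step s k).
rewrite -/(mN f s k (step s k)) -/(trial s k) -/c in upper.
have sq : enorm (step s k) ^+ 2 <= dk ^+ 2.
  by rewrite ler_sqr ?nnegrE ?enorm_ge0 // (le_trans _ hd) // enorm_ge0.
have h1 : c * enorm (step s k) ^+ 2 <= c * dk * dk.
  by rewrite -mulrA -expr2 ler_pM2l.
have h2 : c * dk * dk <= (1 - eta par) * (2^-1 * e) * dk.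
  by rewrite ler_pM2r // mulrC -ler_pdivlMr.
have h3 : (1 - eta par) * (2^-1 * e * dk) <=
          (1 - eta par) * (mN f s k 0 - mN f s k (step s k)).
  by rewrite ler_wpM2l // subr_ge0; lra.
have gpos : 0 < mN f s k 0 - mN f s k (step s k).
  by apply: lt_le_trans gain; rewrite !mulr_gt0 ?invr_gt0.
have ht : 0 <= dk * tseq par k by rewrite mulr_ge0 ?ltW.
rewrite /rhoN ler_ndivlMr; last by rewrite -oppr_gt0 opprB.
rewrite -/dk -mN0; move: h1 h2 h3 upper ht; lra.
Qed.

Lemma recurrent_successes (e : R) : 0 < e ->
  (\forall k \near \oo, e <= omegaN f s k) ->
  (exists2 ds, 0 < ds & \forall k \near \oo, ds <= tr_radius s k) /\
  (forall K, exists2 k, (K <= k)%N & eta par <= rhoN f par s k).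
Proof.
have [_ [/andP[h1 h2] [g1 _]]] := par_valid.
have [[_ s0 _] hk] := path_s.
move=> e0 he; have [d0 d0_gt0 hd0] := small_radius_success e0.
have d00 : 0 < tr_radius s 0 <= delta_max par by rewrite s0 h1 ltW.
have step4s j : tr_radius s j.+1 = if eta par <= rhoN f par s j
    then Num.min (delta_max par) ((gamma1 par)^-1 * tr_radius s j)
    else gamma1 par * tr_radius s j by have [_ _ _ ->] := hk j.
have [ds ds0 hds] := radius_nonvanishing g1 d00 step4s d0_gt0
  (filterS (fun k hk => hd0 k hk) he).
split; first by exists ds.
exact: (infinitely_many_successes g1 step4s ds0 hds).
Qed.

End TrustRegion.
(** * Full-sampling paths *)

Lemma nneseries_partial_sums (R : realType) (t : nat -> R) :
  (forall k, 0 < t k) -> (\sum_(0 <= k <oo) (t k)%:E < +oo)%E ->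
  exists M, forall m, \sum_(0 <= k < m) t k <= M.
Proof.
move=> t0 tfin; have h m : ((\sum_(0 <= k < m) t k)%:E <= \sum_(0 <= k <oo) (t k)%:E)%E.
  rewrite -sumEFin; apply: nneseries_lim_ge => k _ _.
  by rewrite lee_fin ltW.
have fin : (\sum_(0 <= k <oo) (t k)%:E)%E \is a fin_num.
  by rewrite ge0_fin_numE //; apply: nneseries_ge0 => k _ _; rewrite lee_fin ltW.
exists (fine (\sum_(0 <= k <oo) (t k)%:E)) => m.
by rewrite -lee_fin fineK.
Qed.

Lemma uniform_lower_bound (R : realType) (n q N : nat)
    (f : 'I_q.+1 -> 'I_N -> 'rV[R]_n -> R) :
  (forall i j, bounded_below (f i j)) ->
  exists2 lo, lo <= 0 & forall i j x, lo <= f i j x.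
Proof.
move=> hb; have /choice[m hm] (ij : 'I_q.+1 * 'I_N) : exists m, forall x, m <= f ij.1 ij.2 x.
  exact: hb.
exists (- \sum_ij `|m ij|); first by rewrite oppr_le0 sumr_ge0.
move=> i j x; apply: le_trans (hm (i, j) x); rewrite lerNl (bigD1 (i, j)) //=.
apply: (@le_trans _ _ `|m (i, j)|); first by rewrite -normrN ler_norm.
by rewrite lerDl sumr_ge0.
Qed.

Lemma uniform_quad_approx (R : realType) (n q N : nat)
    (f : 'I_q.+1 -> 'I_N -> 'rV[R]_n -> R) :
  (forall i j x, differentiable (f i j) x) -> (forall i j, lipschitz_grad (f i j)) ->
  exists2 L, 0 <= L & forall i j, quad_approx L (f i j).
Proof.
move=> df hl; have /choice[L hL] (ij : 'I_q.+1 * 'I_N) :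
    exists L, 0 <= L /\ quad_approx L (f ij.1 ij.2).
  have [L L0 hL] := lipschitz_quad_approx (df ij.1 ij.2) (hl ij.1 ij.2).
  by exists L.
have L0 ij : 0 <= L ij by have [] := hL ij.
exists (\sum_ij L ij); first by rewrite sumr_ge0.
move=> i j x v; have [_ /(_ x v) h] := hL (i, j); apply: le_trans h _.
by rewrite ler_wpM2r ?exprn_ge0 ?enorm_ge0 // (bigD1 (i, j)) //= lerDl sumr_ge0.
Qed.

Section FullSampling.
Variables (R : realType) (n q N : nat).
Variable f : 'I_q.+1 -> 'I_N -> 'rV[R]_n -> R.
Variables (par : asmop_params R n) (s : sample_path R n q N) (L cb lo : R).
Hypotheses (par_valid : valid_params par) (path_s : asmop_path f par s).
Hypotheses (df : forall i j x, differentiable (f i j) x).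
Hypotheses (L_ge0 : 0 <= L) (f_quad : forall i j, quad_approx L (f i j)).
Hypothesis beta_cb : forall k, beta (hess s k) <= cb.
Hypotheses (lo_le0 : lo <= 0) (f_lo : forall i j x, lo <= f i j x).

(** Otherwise the descent of [phi] along the recurrent successes would force the
    model gains to 0, while omega and the radius keep them away from 0. *)
Lemma full_sampling_omega (K0 : nat) :
  (forall k, (K0 <= k)%N -> forall i, #|batch s k i| = N) ->
  forall e K, 0 < e ->
    exists2 k, (K <= k)%N & omega (objective f) (iterate s k) < e.
Proof.
have [_ [_ [_ [_ [_ [/andP[eta0 _] [t0 [_ [tsum _]]]]]]]]] := par_valid.
have [M hM] := nneseries_partial_sums t0 tsum.
have cb0 := cb_gt0 beta_cb.
move=> full e K e0; apply: contrapT => nex.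
have omega_e k : (K <= k)%N -> e <= omega (objective f) (iterate s k).
  by move=> Kk; rewrite leNgt; apply/negP => lt_e; apply: nex; exists k.
have fNE k : (K0 <= k)%N -> fN f s k = objective f.
  by move=> kK; apply/funext => i; apply: full_set_objective; exact: full.
have omegaN_e : \forall k \near \oo, e <= omegaN f s k.
  exists (maxn K K0) => // k /=; rewrite geq_max => /andP[h1 h2].
  by rewrite /omegaN fNE // omega_e.
have [[ds ds0 hds] succ] :=
  recurrent_successes par_valid path_s df L_ge0 f_quad beta_cb e0 omegaN_e.
pose u k := if eta par <= rhoN f par s k then eta par * model_gain f s cb k else 0.
have gain0 k : 0 <= model_gain f s cb k.
  exact: (model_gain_ge0 par_valid path_s beta_cb).
have u_cvg : u @ \oo --> (0 : R).
  apply: (@descent_cvg0 _ (fun k => phi (objective f) (iterate s k))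
    (fun k => delta_max par * tseq par k) _ lo (delta_max par * M)).
  - move=> k; apply: le_trans (maxq_ge _ ord0).
    by rewrite objective_avg; apply: avg_ge.
  - move=> m; rewrite -mulr_sumr ler_wpM2l //.
    by have [/ltW] := par_valid.
  - by move=> k; rewrite /u; case: ifP => // _; rewrite mulr_ge0 // ltW.
  - exists K0 => // k /= Kk.
    have [_ /(_ k)[_ _ -> _]] := path_s.
    have -> : Mb s k == finset.set0.
      by apply/eqP/setP => i; rewrite !inE full // ltnn.
    have /andP[_ dle] := tr_radius_bounds par_valid path_s k.
    have htt : tr_radius s k * tseq par k <= delta_max par * tseq par k.
      by rewrite ler_pM2r.
    rewrite /u orTb andbT; case: ifP => [hs|_].
      have := success_decrease par_valid path_s beta_cb hs.
      by rewrite fNE //; lra.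
    rewrite subr0 lerDl; apply: le_trans htt.
    by rewrite mulr_ge0 ?ltW //; case/andP: (tr_radius_bounds par_valid path_s k).
pose c := eta par * (2^-1 * e * Num.min ds (e / cb)).
have c0 : 0 < c.
  by rewrite /c mulr_gt0 // !mulr_gt0 ?invr_gt0 // lt_min ds0 divr_gt0.
have [K1 _ hK1] : \forall k \near \oo, u k < c.
  move/cvgrPdist_lt: u_cvg => /(_ _ c0); apply: filterS => k.
  by rewrite sub0r normrN; apply: le_lt_trans; exact: ler_norm.
case: omegaN_e hds => [K2 _ hK2] [K3 _ hK3].
have [k] := succ (maxn K1 (maxn K2 K3)).
rewrite !geq_max => /andP[k1 /andP[k2 k3]] hs.
have := hK1 k k1; rewrite /= /u hs; apply/negP; rewrite -leNgt /c ler_pM2l //.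
have hk2 : e <= omegaN f s k by exact: hK2.
rewrite /model_gain ler_pM //.
- by rewrite mulr_ge0 ?invr_ge0 // ltW.
- by rewrite le_min !ltW ?divr_gt0.
- by rewrite ler_pM2l ?invr_gt0.
- rewrite le_min !ge_min hK3 //=; apply/orP; right.
  by rewrite ler_pM2r ?invr_gt0.
Qed.

End FullSampling.
(** * Mini-batch paths *)

Section MiniBatch.
Variables (R : realType) (n q N : nat).
Variable f : 'I_q.+1 -> 'I_N -> 'rV[R]_n -> R.
Variables (par : asmop_params R n) (s : sample_path R n q N).
Hypotheses (par_valid : valid_params par) (path_s : asmop_path f par s).

Lemma batch_size_le k i : (#|batch s k i| <= N)%N.
Proof. by rewrite -[X in (_ <= X)%N]card_ord; exact: max_card. Qed.

Lemma batch_size_mono k i : (#|batch s k i| <= #|batch s k.+1 i|)%N.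
Proof.
have [_ /(_ k)[_ + _ _]] := path_s; rewrite /step2.
case: ifP => _; first by move=> ->.
move=> [_ _ /(_ i)]; case: ifP => _; first by move=> ->.
by case: ifP => _; [move/ltnW|case: ifP => _ ->].
Qed.

(** A subsampled objective whose batch no longer grows witnesses that neither
    reason for enlarging the batches occurs any more. *)
Lemma minibatch_stationary : Mb_forever s !=set0 ->
  exists K B, B != finset.set0 /\ forall k, (K <= k)%N ->
    [/\ Mb s k = B, forall i, i \in B -> eps par * hfrac s k i <= omegaN f s k
      & rhoD_ge_nu f par s k (dsample s k)].
Proof.
move=> [i0 i0_forever].
have /choice[Ki hKi] i : exists K, forall k, (K <= k)%N -> #|batch s k i| = #|batch s K i|.
  apply: (@nondecreasing_bounded_stationary _ N) => k.
    exact: batch_size_mono.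
  exact: batch_size_le.
pose K := \max_i Ki i.
have stat i k : (K <= k)%N -> #|batch s k i| = #|batch s K i|.
  have KiK : (Ki i <= K)%N by exact: leq_bigmax.
  by move=> Kk; rewrite (hKi i k) ?(leq_trans KiK) // (hKi i K).
have MbK k : (K <= k)%N -> Mb s k = Mb s K.
  by move=> Kk; apply/setP => i; rewrite !inE stat.
exists K, (Mb s K); split.
  by apply/set0Pn; exists i0; exact: i0_forever.
have main k i : (K <= k)%N -> i \in Mb s k ->
    eps par * hfrac s k i <= omegaN f s k /\ rhoD_ge_nu f par s k (dsample s k).
  move=> Kk iM; have [_ /(_ k)[_ + _ _]] := path_s; rewrite /step2 ifN; last first.
    by apply/set0Pn; exists i.
  move=> [_ _ /(_ i)]; rewrite iM /=; case: ifPn => [_|].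
    by rewrite stat // [in X in (_ < X)%N]stat ?ltnn // (leq_trans Kk).
  by rewrite negb_or negbK -leNgt => /andP[].
move=> k Kk; split; first exact: MbK.
  by rewrite -(MbK k Kk) => i iM; have [] := main k i Kk iM.
by have [] := main k i0 Kk (i0_forever k).
Qed.

(** The samples that turn the additional test into a statement about single
    component functions: repeating one index makes the sampled mean equal to the
    component, whatever the positive sample size. *)
Definition constant_sample (B : {set 'I_q.+1}) (m : 'I_q.+1 -> nat)
    (j : 'I_q.+1 -> 'I_N) (i : 'I_q.+1) : seq 'I_N :=
  if i \in B then nseq (m i) (j i) else enum 'I_N.

Variables (L cb lo : R).
Hypotheses (df : forall i j x, differentiable (f i j) x).
Hypotheses (L_ge0 : 0 <= L) (f_quad : forall i j, quad_approx L (f i j)).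
Hypothesis beta_cb : forall k, beta (hess s k) <= cb.
Hypotheses (lo_le0 : lo <= 0) (f_lo : forall i j x, lo <= f i j x).

(** Fixing the subsampled objectives and the sizes makes the conditional
    probability of drawing the sample the same at all iterations k where this
    holds. *)
Definition refuted (B : {set 'I_q.+1}) (m : 'I_q.+1 -> nat)
    (j : 'I_q.+1 -> 'I_N) k : Prop :=
  (Mb s k = B /\ forall i, i \in B -> dsize s k i = m i) /\
  ~~ rhoD_ge_nu f par s k (constant_sample B m j).

(** Once all constant samples pass the test, every component gradient of the
    subsampled objectives, and every gradient of the other objectives, tends to 0
    along the successes, so omega_(N_k)(x_k) cannot stay above eps / N. *)
Lemma minibatch_contradiction : Mb_forever s !=set0 ->
  (forall (B : {set 'I_q.+1}) (m j : {ffun 'I_q.+1 -> 'I_N}),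
     \forall k \near \oo, ~ refuted B (fun i => m i) j k) -> False.
Proof.
have [dmax0 [_ [_ [nu0 [eps0 [_ [_ [tb0 [_ tbsum]]]]]]]]] := par_valid.
have [M hM] := nneseries_partial_sums tb0 tbsum.
move=> MBs nref; have [K [B [Bn0 hK]]] := minibatch_stationary MBs.
have [i0 i0B] := set0Pn _ Bn0.
have N0 : (0 < N)%N.
  have [MK _ _] := hK K (leqnn K).
  by move: i0B; rewrite -MK inE; exact: leq_ltn_trans.
(* A proper subset of an N-element set has h >= 1 / N. *)
pose e := eps par / N%:R.
have e0 : 0 < e by rewrite divr_gt0 // ltr0n.
have omega_e k : (K <= k)%N -> e <= omegaN f s k.
  move=> Kk; have [MK /(_ _ i0B) + _] := hK k Kk.
  apply: le_trans; rewrite ler_pM2l // /hfrac -[leLHS]mul1r.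
  rewrite ler_pM2r ?invr_gt0 ?ltr0n // -natrB ?batch_size_le // ler1n subn_gt0.
  by move: i0B; rewrite -MK inE.
pose G (j : {ffun 'I_q.+1 -> 'I_N}) i := if i \in B then f i (j i) else objective f i.
pose gmax j k := maxq (fun i => enorm (grad (G j i) (iterate s k))).
have G_descent : \forall k \near \oo, forall j,
    phi (G j) (trial s k) <= phi (G j) (iterate s k)
      + tr_radius s k * tbarseq par k - nu par * gmax j k.
  have : \forall k \near \oo, forall m j : {ffun 'I_q.+1 -> 'I_N},
      ~ refuted B (fun i => m i) j k.
    by apply: filter_forall => m; apply: filter_forall => j; exact: nref.
  case=> [K1 _ hK1]; exists (maxn K K1) => // k /=.
  rewrite geq_max => /andP[Kk K1k] j.
  have [MK _ _] := hK k Kk.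
  have dsz i : i \in B -> (0 < dsize s k i < N)%N.
    have [_ /(_ k)[_ + _ _]] := path_s; rewrite /step2 ifN ?MK //.
    by move=> [+ _ _]; exact.
  (* Sizes of subsampled objectives are below N; the default value only serves
     the objectives outside B. *)
  pose m := [ffun i => insubd (Ordinal N0) (dsize s k i)] : {ffun 'I_q.+1 -> 'I_N}.
  have mE i : i \in B -> dsize s k i = m i.
    by move=> iB; rewrite ffunE val_insubd ifT //; have /andP[] := dsz i iB.
  have /(_ m j) := hK1 k K1k; rewrite /refuted.
  move/not_andP => [] h; first by case: h.
  have : rhoD_ge_nu f par s k (constant_sample B (fun i => m i) j) by apply: contrapT => /negP.
  have GE : seq_objective f (constant_sample B (fun i => m i) j) = G j.
    apply/funext => i; apply/funext => x; rewrite seq_objective_avg /constant_sample /G.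
    case: ifP => [iB|_]; last by rewrite objective_avg.
    by rewrite avg_nseq // -mE //; have /andP[] := dsz i iB.
  by rewrite /rhoD_ge_nu GE.
pose u j k := if eta par <= rhoN f par s k then nu par * gmax j k else 0.
have gmax0 j k : 0 <= gmax j k.
  apply: le_trans (enorm_ge0 (grad (G j ord0) (iterate s k))) _.
  exact: (maxq_ge (fun i => enorm (grad (G j i) (iterate s k)))).
have u_cvg j : u j @ \oo --> (0 : R).
  apply: (@descent_cvg0 _ (fun k => phi (G j) (iterate s k))
    (fun k => delta_max par * tbarseq par k) _ lo (delta_max par * M)).
  - move=> k; apply: le_trans (maxq_ge _ ord0); rewrite /G.
    by case: ifP => _ //; rewrite objective_avg; apply: avg_ge.
  - by move=> l; rewrite -mulr_sumr ler_wpM2l // ltW.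
  - by move=> k; rewrite /u; case: ifP => // _; rewrite mulr_ge0 // ltW.
  - case: G_descent => [K1 _ hK1]; exists (maxn K K1) => // k /=.
    rewrite geq_max => /andP[Kk K1k]; have [_ _ rhoD] := hK k Kk.
    have [_ /(_ k)[_ _ -> _]] := path_s; rewrite rhoD orbT andbT.
    have /andP[d_gt0 dle] := tr_radius_bounds par_valid path_s k.
    have htt : tr_radius s k * tbarseq par k <= delta_max par * tbarseq par k.
      by rewrite ler_pM2r.
    rewrite /u; case: ifP => [hs|_]; first by have /(_ j) := hK1 k K1k; lra.
    by rewrite subr0 lerDl; apply: le_trans htt; rewrite mulr_ge0 ?ltW.
have [K1 _ hK1] : \forall k \near \oo, forall j, u j k < nu par * (e / 2).
  apply: filter_forall => j; have c0 : 0 < nu par * (e / 2).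
    by rewrite mulr_gt0 // divr_gt0.
  move/cvgrPdist_lt: (u_cvg j) => /(_ _ c0); apply: filterS => k.
  by rewrite sub0r normrN; apply: le_lt_trans; exact: ler_norm.
have omega_near : \forall k \near \oo, e <= omegaN f s k by exists K.
have [_ succ] :=
  recurrent_successes par_valid path_s df L_ge0 f_quad beta_cb e0 omega_near.
have [k] := succ (maxn K K1); rewrite geq_max => /andP[Kk K1k] hs.
have small j i : enorm (grad (G j i) (iterate s k)) <= e / 2.
  have /(_ j) := hK1 k K1k; rewrite /u hs ltr_pM2l // => /ltW; apply: le_trans.
  exact: (maxq_ge (fun i => enorm (grad (G j i) (iterate s k)))).
have : omegaN f s k <= e / 2.
  apply: le_trans (omega_le _ _) _; apply: maxq_le => i.
  have [MK _ _] := hK k Kk; rewrite /fN; have [iB|iB] := boolP (i \in B).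
    rewrite set_objective_avg; apply: enorm_grad_avg => // [|j].
      by rewrite divr_ge0 ?ltW.
    by have := small [ffun=> j] i; rewrite /G iB ffunE.
  rewrite full_set_objective.
    by have := small [ffun=> Ordinal N0] i; rewrite /G (negPf iB).
  apply/eqP; rewrite eqn_leq batch_size_le /=.
  by move: iB; rewrite -MK inE -leqNgt.
by have := omega_e k Kk; lra.
Qed.

End MiniBatch.
(** * A conditional Borel-Cantelli lemma *)

Section ConditionalBorelCantelli.
Variables (R : realType) (d : measure_display) (T : measurableType d).
Variable P : probability T R.

(** Let U n be the event that F has not yet occurred together with A before time
    n.  Passing from n to n + 1 removes at least a fraction c of U n /\ A n, so the
    probabilities of the events U n /\ A n sum to at most 1 / c, and by the first
    Borel-Cantelli lemma almost surely only finitely many of them occur. *)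
Lemma conditional_borel_cantelli0 (G : nat -> set (set T)) (A F : nat -> set T) (c : R) :
  0 < c ->
  (forall k, sigma_algebra setT (G k)) -> (forall k, G k `<=` measurable) ->
  (forall k, G k `<=` G k.+1) ->
  (forall k, G k (A k)) -> (forall k, G k.+1 (F k)) ->
  (forall k X, G k X -> X `<=` A k -> c%:E * P X <= P (X `&` F k))%E ->
  P.-negligible [set w | (forall K, exists2 k, (K <= k)%N & A k w) /\
                         forall k, ~ (A k `&` F k) w].
Proof.
move=> c0 sG Gm Ginc GA GF hit.
have measG k X : (G k).-sigma.-measurable X = G k X.
  by rewrite measurable_g_measurableTypeE.
have GI k X Y : G k X -> G k Y -> G k (X `&` Y).
  by rewrite -!measG; exact: measurableI.
have GD k X Y : G k X -> G k Y -> G k (X `\` Y).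
  by rewrite -!measG; exact: measurableD.
pose U := fix U n := if n is k.+1 then U k `\` (A k `&` F k) else setT.
have GU n : G n (U n).
  elim: n => [|n IH]; first by rewrite -measG; exact: measurableT.
  by apply: GD; [exact: Ginc|apply: GI; [exact: Ginc|exact: GF]].
pose V n := U n `&` A n.
have GV n : G n (V n) by exact: GI.
have mV n : measurable (V n) by exact: Gm (GV n).
have fP X : measurable X -> P X \is a fin_num by move=> mX; exact: fin_num_measure.
have US n : P (U n.+1) = (P (U n) - P (V n `&` F n))%E.
  have mU : measurable (U n) by exact: Gm (GU n).
  have mAF : measurable (A n `&` F n).
    by apply: (Gm n.+1); apply: GI; [exact: Ginc|exact: GF].
  rewrite /= measureD //; last by rewrite ltey_eq fP.
  by rewrite setIA.
have step n : c * fine (P (V n)) <= fine (P (U n)) - fine (P (U n.+1)).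
  have mVF : measurable (V n `&` F n).
    by apply: (Gm n.+1); apply: GI; [exact: Ginc|exact: GF].
  have mU : measurable (U n) by exact: Gm (GU n).
  have VA : V n `<=` A n by move=> w [].
  have := hit n (V n) (GV n) VA.
  rewrite US fineB ?fP // opprB addrCA subrr addr0.
  by rewrite -lee_fin EFinM !fineK ?fP.
have partial m : \sum_(0 <= n < m) fine (P (V n)) <= c^-1.
  have tele : c * \sum_(0 <= n < m) fine (P (V n)) <= 1 - fine (P (U m)).
    elim: m => [|m IH].
      by rewrite big_geq // mulr0 /= probability_setT subrr.
    by rewrite big_nat_recr //= mulrDr; have := step m; move: IH; rewrite /=; lra.
  rewrite -[c^-1]mul1r ler_pdivlMr // mulrC (le_trans tele) // lerBlDr lerDl.
  by rewrite fine_ge0.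
exists (lim_sup_set V); split.
- apply: bigcap_measurable => [|n _]; first by exists 0.
  by apply: bigcup_measurable => k _; exact: mV.
- apply: lim_sup_set_cvg0 => //.
  apply: (@le_lt_trans _ _ (c^-1)%:E); last exact: ltry.
  apply: lime_le; first by apply: is_cvg_nneseries => n _ _; exact: measure_ge0.
  apply: nearW => m; rewrite (eq_bigr (fun n => (fine (P (V n)))%:E)).
    by rewrite sumEFin lee_fin.
  by move=> n _; rewrite fineK ?fP.
move=> w [Aio AF] K _; have [k Kk Ak] := Aio K.
exists k => //; split => //; elim: {Kk Ak} k => [//|k IH].
by split => //; exact: AF.
Qed.

(** The previous lemma after a shift of time, with a countable union over the
    iteration from which F never accompanies A. *)
Lemma conditional_borel_cantelli (G : nat -> set (set T)) (A F : nat -> set T) (c : R) :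
  0 < c ->
  (forall k, sigma_algebra setT (G k)) -> (forall k, G k `<=` measurable) ->
  (forall k, G k `<=` G k.+1) ->
  (forall k, G k (A k)) -> (forall k, G k.+1 (F k)) ->
  (forall k X, G k X -> X `<=` A k -> c%:E * P X <= P (X `&` F k))%E ->
  P.-negligible [set w | (forall K, exists2 k, (K <= k)%N & A k w) /\
                         \forall k \near \oo, ~ (A k `&` F k) w].
Proof.
move=> c0 sG Gm Ginc GA GF hit.
pose Z K := [set w | (forall K', exists2 k, (K' <= k)%N & A (k + K)%N w) /\
                     forall k, ~ (A (k + K)%N `&` F (k + K)%N) w].
apply: (@negligibleS _ _ _ _ (\bigcup_K Z K)).
  move=> w [Aio [K _ hK]]; exists K => //; split.
    move=> K'; have [k] := Aio (K' + K)%N; exists (k - K)%N.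
      by rewrite leq_subRL ?(leq_trans (leq_addl K' K)) // addnC.
    by rewrite subnK // (leq_trans (leq_addl K' K)).
  by move=> k; apply: hK; rewrite /= leq_addl.
apply: negligible_bigcup => K.
exact: (@conditional_borel_cantelli0 (fun k => G (k + K)%N) (fun k => A (k + K)%N)
  (fun k => F (k + K)%N) c c0
  (fun k => sG _) (fun k => Gm _) (fun k => Ginc _) (fun k => GA _)
  (fun k => GF _) (fun k => hit _)).
Qed.

End ConditionalBorelCantelli.

(** * Measurability of the test *)

Lemma continuous_maxq (T : topologicalType) (R : realType) (q : nat)
    (a : 'I_q.+1 -> T -> R) : (forall i, continuous (a i)) ->
  continuous (fun x => maxq (fun i => a i x)).
Proof.
move=> ca x; apply/cvgrPdist_le => e e0.
have : \forall y \near x, forall i, `|a i x - a i y| <= e.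
  by apply: filter_forall => i; have /cvgrPdist_le := ca i x; exact.
apply: filterS => y hy; rewrite ler_norml lerNl opprB !lerBlDl.
by apply/andP; split; apply: le_maxqD => i; have := hy i;
  rewrite ler_norml => /andP[]; lra.
Qed.

Section Measurability.
Variables (R : realType) (d : measure_display) (T : measurableType d).

Lemma measurable_forall (I : finType) (F : I -> set T) :
  (forall i, measurable (F i)) -> measurable [set w | forall i, F i w].
Proof.
move=> mF; rewrite (_ : [set _ | _] = ~` \bigcup_(i in setT) ~` F i).
  apply: measurableC; apply: fin_bigcup_measurable => //.
  by move=> i _; exact: measurableC.
apply/seteqP; split => [w h [i _]|w h i]; first by apply; exact: h.
by apply: contrapT => nF; apply: h; exists i.
Qed.

(** The space S carries no sigma-algebra: only open sets are known to have
    measurable preimages, which is the form in which the history provides random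
    points. *)
Lemma measurable_continuous_comp (S : topologicalType) (X : T -> S) (g : S -> R) :
  (forall U, open U -> measurable (X @^-1` U)) -> continuous g ->
  measurable_fun setT (g \o X).
Proof.
move=> mX /continuousP cg; apply: (measurability _ (RGenOpens.measurableE R)).
move=> _ [_ [a [b ->] <-]]; rewrite setTI comp_preimage.
by apply: mX; apply: cg; exact: interval_open.
Qed.

End Measurability.
(** * The mini-batch scenario is negligible *)

Section MiniBatchNegligible.
Variables (R : realType) (n q N : nat).
Variable f : 'I_q.+1 -> 'I_N -> 'rV[R]_n -> R.
Variable par : asmop_params R n.
Variables (d : measure_display) (T : measurableType d) (P : probability T R).
Variable run : T -> sample_path R n q N.
Hypotheses (df : forall i j x, differentiable (f i j) x).
Hypothesis cgrad : forall i j, continuous (grad (f i j)).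

(** The test only involves continuous functions of the current point and of the
    trial point, and the radius; so its outcome for a fixed sample is known when
    D_k is about to be drawn. *)
Lemma refuted_history (G : nat -> set (set T)) (B : {set 'I_q.+1})
    (m : 'I_q.+1 -> nat) (j : 'I_q.+1 -> 'I_N) k :
  history run G -> G k [set w | refuted f par (run w) B m j k].
Proof.
move=> [sG [_ [_ [Gx [Gdelta [Gbatch [Gdsize _]]]]]]].
have measG X : (G k).-sigma.-measurable X = G k X.
  by rewrite measurable_g_measurableTypeE.
pose T' := g_sigma_algebraType (G k).
have mMb : (G k).-sigma.-measurable [set w : T' | Mb (run w) k = B].
  rewrite (_ : [set _ | _] = [set w : T' | forall i, (i \in Mb (run w) k) = (i \in B)]).
    apply: measurable_forall => i.
    rewrite [X in measurable X](_ : _ =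
      \bigcup_(S in [set S : {set 'I_N} | (#|S| < N)%N = (i \in B)])
        [set w : T' | batch (run w) k i = S]).
      apply: fin_bigcup_measurable; first exact: finite_finset.
      by move=> S _; rewrite measG; exact: Gbatch.
    apply/seteqP; split => [w /= h|w [S /= h1 h2]].
      by exists (batch (run w) k i) => //=; move: h; rewrite inE.
    by rewrite inE h2.
  by apply/seteqP; split => [w /= -> //|w /= h]; exact/setP.
have mdsize : (G k).-sigma.-measurable
    [set w : T' | forall i, i \in B -> dsize (run w) k i = m i].
  apply: measurable_forall => i; have [iB|iB] := boolP (i \in B).
    rewrite [X in measurable X](_ : _ = [set w : T' | dsize (run w) k i = m i]).
      by rewrite measG; exact: Gdsize.
    by apply/seteqP; split => w /=; [exact|move=> ->].
  by rewrite [X in measurable X](_ : _ = setT) //; apply/seteqP; split.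
pose D := constant_sample B m j.
have mx (g : 'rV[R]_n -> R) : continuous g ->
    measurable_fun setT ((g \o (fun w => iterate (run w) k)) : T' -> R).
  apply: measurable_continuous_comp => U oU; rewrite measG.
  by have [] := Gx k U oU.
have mt (g : 'rV[R]_n -> R) : continuous g ->
    measurable_fun setT ((g \o (fun w => trial (run w) k)) : T' -> R).
  apply: measurable_continuous_comp => U oU; rewrite measG.
  by have [] := Gx k U oU.
have mdelta : measurable_fun setT ((fun w => tr_radius (run w) k) : T' -> R).
  by move=> _ Y mY; rewrite setTI measG; exact: Gdelta.
have cphi : continuous (phi (seq_objective f D)).
  apply: continuous_maxq => i; rewrite seq_objective_avg => x.
  by apply: differentiable_continuous; exact: differentiable_avg.
have cg : continuous (fun x => maxq (fun i => enorm (grad (seq_objective f D i) x))).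
  apply: continuous_maxq => i; rewrite seq_objective_avg => x.
  apply: (@continuous_comp _ _ _ (grad (avg (f i) (D i))) (@enorm R n)).
    exact: continuous_grad_avg.
  exact: continuous_enorm.
rewrite -measG (_ : [set _ | _] = ([set w : T' | Mb (run w) k = B] `&`
   [set w : T' | forall i, i \in B -> dsize (run w) k i = m i]) `&`
   ~` [set w : T' | rhoD_ge_nu f par (run w) k D]); last first.
  apply/seteqP; split => [w [[h1 h2] /negP h3] //|w [[h1 h2] h3]].
  by split=> //; apply/negP.
apply: measurableI; first exact: measurableI.
apply: measurableC.
rewrite -[X in measurable X]setTI.
apply: measurable_fun_le => //; first exact: mt cphi.
apply: measurable_funB.
  apply: measurable_funD; first exact: mx cphi.
  by apply: measurable_funM => //; exact: measurable_cst.
by apply: measurable_funM; [exact: measurable_cst|exact: mx cg].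
Qed.

Variables (L cb lo : R).
Hypothesis par_valid : valid_params par.
Hypothesis run_asmop : asmop_process f par P run.
Hypotheses (L_ge0 : 0 <= L) (f_quad : forall i j, quad_approx L (f i j)).
Hypothesis beta_cb : forall w k, beta (hess (run w) k) <= cb.
Hypotheses (lo_le0 : lo <= 0) (f_lo : forall i j x, lo <= f i j x).

(** There are finitely many triples of a set of subsampled objectives, sizes and
    repeated indices, and for each of them the conditional Borel-Cantelli lemma
    applies: the probability of drawing the corresponding sample is a positive
    constant.  On a mini-batch path a sample failing the test is eventually never
    drawn, so outside a null set it is eventually not refuted either. *)
Lemma minibatch_negligible : P.-negligible (MB run).
Proof.
have [paths [G [hG unif]]] := run_asmop.
(* The initial batches are nonempty sets of indices below N. *)
have N0 : (0 < N)%N.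
  have [[_ _ /(_ ord0) /set0Pn[[i iN] _]] _] := paths point.
  exact: leq_ltn_trans iN.
pose drawn (B : {set 'I_q.+1}) (m j : {ffun 'I_q.+1 -> 'I_N}) k :=
  [set w | forall i, i \in B ->
     dsample (run w) k i = constant_sample B (fun i => m i) j i].
pose A B (m j : {ffun 'I_q.+1 -> 'I_N}) k :=
  [set w | refuted f par (run w) B (fun i => m i) j k].
pose bad t := [set w | (forall K, exists2 k, (K <= k)%N & A t.1.1 t.1.2 t.2 k w) /\
   \forall k \near \oo, ~ (A t.1.1 t.1.2 t.2 k `&` drawn t.1.1 t.1.2 t.2 k) w].
apply: (@negligibleS _ _ _ _ (\bigcup_l (if unpickle l is Some t then bad t else set0))).
  move=> w wMB; apply: contrapT => nbad.
  apply: (@minibatch_contradiction _ _ _ _ f par (run w) par_valid (paths w)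
    L cb lo df L_ge0 f_quad (beta_cb w) lo_le0 f_lo wMB) => B m j.
  have [K [B' [B'n0 hK]]] := minibatch_stationary (paths w) wMB.
  have nrf : \forall k \near \oo, ~ (A B m j k `&` drawn B m j k) w.
    exists K => // k /= Kk [[[MK _] /negP nge] dr]; apply: nge.
    have [_ _] := hK k Kk; congr (is_true (rhoD_ge_nu _ _ _ _ _)).
    apply/funext => i; have [iB|iB] := boolP (i \in B); first exact: dr.
    have [_ /(_ k)[_ + _ _]] := paths w; rewrite /step2.
    case: ifP => [/eqP M0|_]; last first.
      move=> [_ /(_ i) + _]; rewrite MK (negPf iB) => ->.
      by rewrite /constant_sample (negPf iB).
    by have [+ _ _] := hK k Kk; rewrite M0 => E; rewrite -E eqxx in B'n0.
  apply: contrapT => nevent; apply: nbad.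
  exists (pickle (B, m, j)); first exact: I.
  rewrite pickleK; split; last exact: nrf.
  move=> K'.
  apply: contrapT => nex; apply: nevent; exists K' => // k /= Kk rf.
  by apply: nex; exists k.
apply: negligible_bigcup => l; case: (unpickle l) => [[[B m] j]|]; last first.
  exact: negligible_set0.
have c0 : 0 < \prod_(i in B) N%:R^-1 ^+ m i :> R.
  by rewrite prodr_gt0 // => i _; rewrite exprn_gt0 // invr_gt0 ltr0n.
have [sG [Gm [Ginc [_ [_ [_ [_ Gdraw]]]]]]] := hG.
apply: (@conditional_borel_cantelli _ _ _ _ G _ _ _ c0) => //.
- by move=> k; exact: refuted_history.
- move=> k; rewrite -(measurable_g_measurableTypeE (sG k.+1)).
  apply: (@measurable_forall _ (g_sigma_algebraType (G k.+1))) => i.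
  have [iB|iB] := boolP (i \in B).
    rewrite [X in measurable X](_ : _ = [set w |
        dsample (run w) k i = constant_sample B (fun i => m i) j i]).
      by rewrite measurable_g_measurableTypeE //; exact: Gdraw.
    by apply/seteqP; split => w /=; [exact|move=> ->].
  by rewrite [X in measurable X](_ : _ = setT) //; apply/seteqP; split.
move=> k X GX XA.
have sizes i : i \in B -> size (constant_sample B (fun i => m i) j i) = m i.
  by move=> iB; rewrite /constant_sample iB size_nseq.
have := unif k B (fun i => m i) X GX (fun w Xw => (XA w Xw).1) _ sizes.
by rewrite muleC => <-.
Qed.

End MiniBatchNegligible.
(** * Cluster points and the almost sure limit *)

Lemma limn_einf_eq0 (R : realType) (u : nat -> R) : (forall k, 0 <= u k) ->
  (forall e K, 0 < e -> exists2 k, (K <= k)%N & u k < e) ->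
  limn_einf (fun k => (u k)%:E) = 0%E.
Proof.
move=> u0 small; rewrite limn_einf_lim (_ : einfs _ = cst 0%E) ?lim_cst //.
apply/funext => K; apply/eqP; rewrite /einfs eq_le; apply/andP; split; last first.
  by apply: le_ereal_inf_tmp => _ [k _ <-]; rewrite lee_fin.
apply/lee_addgt0Pr => e e0; rewrite add0e.
have [k Kk uk] := small e K e0.
apply: (@le_trans _ _ (u k)%:E); last by rewrite lee_fin ltW.
by apply: ereal_inf_lbound; exists k.
Qed.

Section CriticalClusterPoint.
Variables (R : realType) (n q : nat) (F : 'I_q.+1 -> 'rV[R]_n -> R).
Hypothesis cgrad : forall i, continuous (grad (F i)).

(** A common descent direction at z remains one near z, with slopes bounded away
    from 0; scaling it into the unit ball gives the lower bound on omega. *)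
Lemma omega_away_from_zero z : ~ pareto_critical F z ->
  exists2 r, 0 < r & \forall y \near z, r <= omega F y.
Proof.
move=> /contrapT[v hv]; pose h y := maxq (fun i => dotv (grad (F i) y) v).
have hz : h z < 0 by exact: maxq_lt.
have ch : continuous h.
  apply: continuous_maxq => i y.
  apply: (@continuous_comp _ _ _ (grad (F i)) (fun g => dotv g v)).
    exact: cgrad.
  exact: continuous_dotvl.
have v1 : 0 < 1 + enorm v by rewrite ltr_wpDr ?enorm_ge0.
exists ((1 + enorm v)^-1 * (- h z / 2)).
  by rewrite mulr_gt0 ?invr_gt0 // divr_gt0 // oppr_gt0.
have hz2 : h z < h z / 2 by lra.
have hlt : \forall y \near z, h y < h z / 2.
  exact: (cvgr_lt (h z) (ch z) _ hz2).
apply: filterS hlt => y hy; apply: le_trans (omega_ge F y (v := (1 + enorm v)^-1 *: v) _).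
  rewrite lerNr -mulrN mulNr opprK; apply: maxq_le => i.
  rewrite dotvZr ler_pM2l ?invr_gt0 //; apply: le_trans (ltW hy).
  exact: (maxq_ge (fun i => dotv (grad (F i) y) v)).
rewrite enormZ ger0_norm ?invr_ge0 ?(ltW v1) // mulrC ler_pdivrMr // mul1r.
by rewrite lerDr ler01.
Qed.

Lemma bounded_cluster_critical (x : nat -> 'rV[R]_n) :
  (forall e K, 0 < e -> exists2 k, (K <= k)%N & omega F (x k) < e) ->
  bounded_set (range x) ->
  exists2 z, cluster (x @ \oo) z & pareto_critical F z.
Proof.
move=> small [M [_ hM]].
have /choice[kappa hk] m : exists k, (m <= k)%N /\ omega F (x k) < m.+1%:R^-1.
  have [|k mk sk] := small m.+1%:R^-1 m; last by exists k.
  by rewrite invr_gt0.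
pose A := [set y : 'rV[R]_n | `|y| <= M + 1].
have cptA : compact A.
  apply: bounded_closed_compact.
    exists (M + 1); split; first exact: num_real.
    by move=> M' /ltW MM' y /= hy; exact: le_trans MM'.
  rewrite (_ : A = (fun y : 'rV[R]_n => `|y|) @^-1` [set t | t <= M + 1]) //.
  by apply: preimage_closed => // y _; exact: norm_continuous.
have yA : ((x \o kappa) @ \oo) A.
  by exists 0 => // m _; apply: (hM (M + 1)); [rewrite ltrDl|exists (kappa m)].
have [z [_ clz]] := cptA _ _ yA; exists z.
  apply: cvg_cluster clz => U [K _ hK]; exists K => // m /= Km.
  by apply: hK; rewrite /= (leq_trans Km) //; have [] := hk m.
apply: contrapT => ncrit; have [r r0 near_r] := omega_away_from_zero ncrit.
have tail : ((x \o kappa) @ \oo) [set y | omega F y < r].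
  have : m.+1%:R^-1 @[m --> \oo] --> (0 : R) by exact: cvg_harmonic.
  move=> /cvgrPdist_lt /(_ _ r0); apply: filterS => m /=.
  rewrite sub0r normrN ger0_norm ?invr_ge0 //; apply: lt_trans.
  by have [] := hk m.
have [y [/= h1 h2]] := clz _ _ tail near_r.
by have := lt_le_trans h1 h2; rewrite ltxx.
Qed.

End CriticalClusterPoint.

Unset Implicit Arguments.

Theorem corollary4p2
  (R : realType) (n q N : nat)
  (f : 'I_q.+1 -> 'I_N -> 'rV[R]_n -> R)
  (par : asmop_params R n)
  (d : measure_display) (T : measurableType d) (P : probability T R)
  (run : T -> sample_path R n q N)
  (k0 k1 : T -> nat)
  (f_lipschitz : forall i j, lipschitz_grad (f i j))
  (par_valid : valid_params par)
  (run_asmop : asmop_process f par P run)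
  (k0P : is_k0 f par run k0)
  (k1P : is_k1 run k1)
  (A1 : assumption1 f)
  (A2 : assumption2 f run)
  (A3 : assumption3 f P run k0 k1) :
  {ae P, forall w,
    limn_einf (fun k => (omega (objective f) (iterate (run w) k))%:E) = 0%E}
  /\
  {ae P, forall w,
    bounded_set (range (iterate (run w))) ->
    exists2 x : 'rV[R]_n,
      cluster (iterate (run w) @ \oo) x & pareto_critical (objective f) x}.
Proof.
have df i j x : differentiable (f i j) x by have [[+ _ _] _] := A1 i j; exact.
have cgrad i j : continuous (grad (f i j)).
  have [[_ dg _] _] := A1 i j.
  by move=> x; exact: differentiable_continuous (dg x).
have [lo lo0 f_lo] := uniform_lower_bound (fun i j => (A1 i j).2).
have [L L0 f_quad] := uniform_quad_approx df f_lipschitz.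
have [_ [cb _ beta_cb]] := A2; have [paths _] := run_asmop.
have FS_small w : ~ MB run w -> forall e K, 0 < e ->
    exists2 k, (K <= k)%N & omega (objective f) (iterate (run w) k) < e.
  move=> nMB.
  have /choice[Ki hKi] i : exists K, forall k, (K <= k)%N -> #|batch (run w) k i| = N.
    apply: contrapT => nfull; apply: nMB; exists i => k; rewrite inE ltnNge.
    apply/negP => fullk; apply: nfull; exists k => l kl.
    apply/eqP; rewrite eqn_leq batch_size_le (leq_trans fullk) //.
    rewrite -(subnK kl); elim: (l - k)%N => // r IH; rewrite addSn.
    exact: leq_trans IH (batch_size_mono (paths w) _ _).
  apply: (full_sampling_omega par_valid (paths w) df L0 f_quad (beta_cb w) lo0 f_lo
    (K0 := \max_i Ki i)) => k Kk i.
  by apply: hKi; apply: leq_trans Kk; exact: leq_bigmax.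
have MB0 := minibatch_negligible df cgrad par_valid run_asmop L0 f_quad beta_cb lo0 f_lo.
split; apply: (negligibleS _ MB0) => w; apply: contra_notP => nMB.
  apply: limn_einf_eq0; first by move=> k; exact: omega_ge0.
  exact: FS_small.
move=> bnd; apply: bounded_cluster_critical => // [i|].
  by rewrite objective_avg; exact: continuous_grad_avg.
exact: FS_small.
Qed.
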